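(* Fix $d\ge2$ and let $G_N=(V_N,E_N)$ be the $d$-dimensional discrete torus $\mathbb T^d_N=(\mathbb Z/N\mathbb Z)^d$ with nearest-neighbor edges. Put i.i.d. heavy-tailed weights on the vertices as described in the context. Let $$\ell_N=\begin{cases}N^{1/2}&d\ge3,\\ N/(\log N)^{1/4}&d=2,\end{cases}\qquad L_N=\begin{cases}(\log N)^2&d\ge3,\\ (\log N)^{1/4}&d=2.\end{cases}$$ Then: (i) if $\mathfrak x,\mathfrak y$ are chosen independently and uniformly in $V_N$, then $\lim_{N\to\infty}\mathbb P[(\mathfrak x,B(\mathfrak x,\ell_N))\not\equiv(\mathfrak y,B(\mathfrak y,\ell_N))]=0$; (ii) for every increasing sequence of integers $J_N$ with $J_N\to\infty$, $\lim_{N\to\infty}\mathbb E[\nu_N(\{x^N_1,\dots,x^N_{\min\{J_N,|V_N|\}}\}^c)]=0$; (iii) for $\mathfrak x$ uniform in $V_N$, $\lim_{N\to\infty}\mathbb E[|B(\mathfrak x,2\ell_N)|/|V_N|]=0$; (iv) for $\mathfrak x$ uniform in $V_N$, $\lim_{N\to\infty}\mathbb E\big[\sup_{y\notin B(\mathfrak x,\ell_N)}\mathbf P^N_y[\mathbb H_{\mathfrak x}\le L_Nt^N_{\mathrm{mix}}]\big]=0$.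
   Context: Weights: $\{W^N_j:j\ge1\}$ are i.i.d. strictly positive random variables with law not depending on $N$ and $\mathbb P[W^N_1>t]=L(t)t^{-\alpha}$, $t>0$, where $0<\alpha<1$ and $L$ is slowly varying at infinity. $\hat W^N_1\ge\dots\ge\hat W^N_{|V_N|}$ is the decreasing rearrangement of $W^N_1,\dots,W^N_{|V_N|}$, $(x^N_1,\dots,x^N_{|V_N|})$ is an independent uniformly random enumeration of $V_N$, and $W^N_{x^N_j}=\hat W^N_j$. $\nu_N(x)=\deg(x)W^N_x/\sum_{y\in V_N}\deg(y)W^N_y$. $B(x,\ell)$ is the ball of radius $\ell$ about $x$ in graph distance. $\mathbf P^N_x$ is the law of the lazy discrete-time random walk on $G_N$ started at $x$ (stay with probability $1/2$, otherwise jump to a uniform neighbor); $\mathbb H_x$ is its hitting time of $x$; $t^N_{\mathrm{mix}}$ is its mixing time, i.e. the least $t$ such that the maximum over starting points of the total variation distance between the law at time $t$ and the stationary law is at most $1/4$. $(\mathfrak x,A)\equiv(\mathfrak y,B)$, for $\mathfrak x\in A\subset V_N$, $\mathfrak y\in B\subset V_N$, means there is a bijection $\varphi:A\to B$ with $\varphi(\mathfrak x)=\mathfrak y$ such that $\{a,b\}\in E_N$ iff $\{\varphi(a),\varphi(b)\}\in E_N$ for all $a,b\in A$. *)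

(* Defs.v *)
From HB Require Import structures.
From mathcomp Require Import all_boot all_order all_algebra.
From mathcomp Require Import all_classical all_reals all_analysis.

Set Implicit Arguments.
Unset Strict Implicit.
Unset Printing Implicit Defensive.

Import Order.TTheory GRing.Theory Num.Theory.
Import numFieldNormedType.Exports.

Local Open Scope classical_set_scope.
Local Open Scope ring_scope.

(* A finite simple graph is a symmetric irreflexive relation on a finType. *)
Section Graph.
Context {R : realType} {V : finType}.
Variable e : rel V.

Definition deg (x : V) : nat := #|[pred y | e x y]|.

Definition joined_by (n : nat) (x y : V) : bool :=
  [exists p : n.-tuple V, path e x p && (last x p == y)].

(* Vertices in the same component are joined by a path with fewer than #|V|
   steps; in different components the value is #|V|. *)
Definition gdist (x y : V) : nat :=
  find (fun n => joined_by n x y) (iota 0 #|V|).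

Definition gball (x : V) (l : R) : {set V} :=
  finset (fun y => (gdist x y)%:R <= l).

(* A bijection A -> B is the restriction to A of a map on V. *)
Definition rooted_equiv (x : V) (A : {set V}) (y : V) (B : {set V}) : Prop :=
  exists phi : V -> V,
    [/\ {in A &, injective phi}, (phi @: A)%SET = B, phi x = y
      & {in A &, forall a b, e a b <-> e (phi a) (phi b)}].

Definition lazy_kernel (x y : V) : R :=
  2^-1 * (x == y)%:R + 2^-1 * ((e x y)%:R / (deg x)%:R).

Definition stationary_law (x : V) : R :=
  (deg x)%:R / (\sum_y deg y)%:R.

Lemma stationary_lawP (y : V) : symmetric e -> (forall x, 0 < deg x)%N ->
  \sum_x stationary_law x * lazy_kernel x y = stationary_law y.
Proof.
move=> esym dpos; set D : R := (\sum_z deg z)%:R.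
have E x : stationary_law x * lazy_kernel x y =
    2^-1 * (stationary_law x * (x == y)%:R) + 2^-1 * D^-1 * (e y x)%:R.
  have d0 : (deg x)%:R != 0 :> R by rewrite pnatr_eq0 -lt0n.
  rewrite /lazy_kernel mulrDr (mulrCA (stationary_law x)); congr (_ + _).
  rewrite /stationary_law -/D (esym x y).
  rewrite mulrCA -[RHS]mulrA; congr (_ * _).
  by rewrite (mulrC _ D^-1) -mulrA; congr (_ * _); rewrite mulrCA mulfV ?mulr1.
rewrite (eq_bigr _ (fun x _ => E x)) big_split/= -!mulr_sumr.
rewrite (bigD1 y)//= eqxx mulr1 big1 ?addr0; last first.
  by move=> x /negbTE ->; rewrite mulr0.
have -> : \sum_x (e y x)%:R = (deg y)%:R :> R.
  rewrite -natr_sum; congr _%:R; rewrite /deg -sum1_card [RHS]big_mkcond/=.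
  by apply: eq_bigr => x _; rewrite inE; case: (e y x).
rewrite -mulrA (mulrC D^-1) -/(stationary_law y).
by rewrite -mulrDl -(mulr1 2^-1) -mulrDr -[1 + 1]/(2%:R) mulVf ?mul1r ?pnatr_eq0.
Qed.

(* Under Q x, the coordinate process Z is the lazy random walk started at x:
   the finite-dimensional distributions are prescribed. *)
Definition is_lazy_walk d (Om : measurableType d) (Q : V -> probability Om R)
    (Z : nat -> Om -> V) : Prop :=
  (forall n v, measurable (Z n @^-1` [set v])) /\
  (forall (x : V) (n : nat) (s : nat -> V),
    Q x [set w | forall k, (k <= n)%N -> Z k w = s k] =
    ((x == s 0%N)%:R * \prod_(k < n) lazy_kernel (s k) (s k.+1))%:E).

End Graph.

Section Walk.
Context {R : realType} {V : finType} {d : measure_display}.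
Context {Om : measurableType d}.

Definition hitting_time (Z : nat -> Om -> V) (x : V) (w : Om) : \bar R :=
  ereal_inf [set (n%:R)%:E | n in [set n : nat | Z n w = x]].

Definition total_variation (p q : V -> R) : R :=
  \big[Num.max/0]_(A : {set V}) `|\sum_(v in A) p v - \sum_(v in A) q v|.

Definition law_at (Q : V -> probability Om R) (Z : nat -> Om -> V)
    (t : nat) (x v : V) : R :=
  fine (Q x (Z t @^-1` [set v])).

(* Equal to +oo when no time is admissible. *)
Definition mixing_time (e : rel V) (Q : V -> probability Om R)
    (Z : nat -> Om -> V) : \bar R :=
  ereal_inf [set (t%:R)%:E | t in [set t : nat |
    \big[Num.max/0]_(x : V)
      total_variation (law_at Q Z t x) (stationary_law e) <= 4^-1]].

End Walk.

(* For N > 1, 'Z_N is the ring Z/NZ; 'Z_0 and 'Z_1 are Z/2Z. *)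
Definition torus (d N : nat) : finType := {ffun 'I_d -> 'Z_N}.

Definition unit_vec (d N : nat) (i : 'I_d) : {ffun 'I_d -> 'Z_N} :=
  [ffun j => (j == i)%:R].

Definition torus_adj (d N : nat) : rel (torus d N) :=
  fun x y : {ffun 'I_d -> 'Z_N} =>
    [exists i, (y == x + unit_vec N i) || (y == x - unit_vec N i)].
Arguments torus_adj : clear implicits.

Definition ell {R : realType} (d N : nat) : R :=
  if d == 2%N then N%:R / (ln N%:R) `^ (4^-1) else N%:R `^ (2^-1).

Definition Lscale {R : realType} (d N : nat) : R :=
  if d == 2%N then (ln N%:R) `^ (4^-1) else (ln N%:R) ^+ 2.

Definition slowly_varying {R : realType} (L : R -> R) : Prop :=
  [/\ measurable_fun (`]0, +oo[ : set R) L,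
      \forall t \near +oo, 0 < L t
    & forall c : R, 0 < c -> L (c * t) / L t @[t --> +oo] --> (1 : R)].

Section Probability.
Context {R : realType} {d : measure_display} {T : measurableType d}.
Variable P : probability T R.

Definition uniform_on (F : finType) (A : {pred F}) (X : T -> F) : Prop :=
  forall a, measurable (X @^-1` [set a]) /\
            P (X @^-1` [set a]) = ((a \in A)%:R / #|A|%:R)%:E.

Definition indep_pair (F G : finType) (X : T -> F) (Y : T -> G) : Prop :=
  forall a b, P (X @^-1` [set a] `&` Y @^-1` [set b]) =
              (P (X @^-1` [set a]) * P (Y @^-1` [set b]))%E.

Definition iid_with_law (mu : probability (measurableTypeR R) R)
    (W : nat -> {RV P >-> R}) : Prop :=
  (forall j (A : set R), measurable A -> P (W j @^-1` A) = mu A) /\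
  (forall (s : seq nat) (A : nat -> set R), uniq s ->
    (forall j, measurable (A j)) ->
    P (\bigcap_(j in [set` s]) (W j @^-1` A j)) =
    (\prod_(j <- s) P (W j @^-1` A j))%E).

Definition sigma_of (W : nat -> {RV P >-> R}) : set (set T) :=
  <<s [set B | exists j A, measurable A /\ B = W j @^-1` A] >>.

Definition indep_of_family (F : finType) (X : T -> F)
    (W : nat -> {RV P >-> R}) : Prop :=
  forall a B, sigma_of W B ->
    P (X @^-1` [set a] `&` B) = (P (X @^-1` [set a]) * P B)%E.

(* Indices start at 0: the weight usually written W_j, j >= 1, is W (j - 1), and likewise for the
   j-th entry of an enumeration; an enumeration of V is a duplicate-free tuple
   of length #|V|. *)
Variable V : finType.

Definition random_enumeration (W : nat -> {RV P >-> R})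
    (xs : T -> #|V|.-tuple V) : Prop :=
  uniform_on [pred t : #|V|.-tuple V | uniq t] xs /\ indep_of_family xs W.

Definition ordered_weights (W : nat -> {RV P >-> R}) (w : T) : seq R :=
  sort (fun a b => b <= a) [seq W j w | j <- iota 0 #|V|].

Definition vertex_weight (W : nat -> {RV P >-> R}) (xs : T -> #|V|.-tuple V)
    (w : T) (v : V) : R :=
  nth 0 (ordered_weights W w) (index v (xs w)).

Definition nu (e : rel V) (W : nat -> {RV P >-> R}) (xs : T -> #|V|.-tuple V)
    (w : T) (v : V) : R :=
  (deg e v)%:R * vertex_weight W xs w v /
  \sum_y (deg e y)%:R * vertex_weight W xs w y.

End Probability.

(* Main.v *)
Require Import Defs.
From HB Require Import structures.
From mathcomp Require Import all_boot all_order all_algebra.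
From mathcomp Require Import all_classical all_reals all_analysis.
From mathcomp Require Import measurable_realfun zify ring lra.

Set Implicit Arguments.
Unset Strict Implicit.
Unset Printing Implicit Defensive.

Import Order.TTheory GRing.Theory Num.Theory.
Import numFieldNormedType.Exports.

Local Open Scope classical_set_scope.
Local Open Scope ring_scope.

(* Balls of the same radius are translates of each other, and they have at most (2k+1)^d points;
   this gives (i) and (iii).

   (iv) Discrete Fourier analysis on the torus gives
   p_t(y,x) <= (1/N + v)^d whenever 4d <= v^2 t, a mixing time of order N^2, and, for d = 2,
   p_t(x,x) >= 1/(64t), so that the Green function up to time N is at least (ln N)/64.
   From y outside B(x, ell) the walk is unlikely to hit x before time t0, since the squared
   distance to y has drift at most 1/2; after t0 the hitting probability is at most the expected
   number of visits after t0 divided by the Green function at x.  One takes t0 ~ N^(1/2) for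
   d >= 3 and t0 ~ N^2 / (ln N)^(3/4) for d = 2.

   (ii) Let g(k) be the tail at 2^k and n = N^d.  Slow variation makes 2^k g(k) grow
   geometrically, so the mean of the weight truncated at 2^k is O(2^k g(k)).  Choose k with
   n g(k) >= K > n g(k+1): some weight exceeds 2^k with probability at least 1 - 1/K, on average
   at most 2^(m+1) K weights exceed 2^(k-m), and the weights up to 2^(k-m) sum to a small
   multiple of 2^k when m is large. *)

(** The Fourier bound on the heat kernel is uniform in the starting point: it does not see the
    distance to x and is useless at early times. Hence the cut at t0, with the drift argument before
    it. After t0 the two cases differ. For d >= 3 the kernel is at most of order t^(-3/2) + N^-3, so
    the expected visits are themselves small and the trivial lower bound 1 on the Green function is
    enough. For d = 2 the bound on the expected visits is of order a^3, where a = (ln N)^(1/4), and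
    only division by a Green function of order a^4 makes it small. The radius N/a and the cut
    N^2/a^3 make the early and the late error both of order 1/a, while the horizon a N^2 adds only
    O(a) visits. In (ii), J_N may grow arbitrarily slowly, so K and m are fixed by the tolerance
    before N. Dyadic levels reduce slow variation to a bound on successive ratios, which is iterated
    geometrically in place of Potter bounds. *)

Section Chain.
Context {R : realType} {V : finType}.
Variable K : V -> V -> R.
Hypothesis K_ge0 : forall y z, 0 <= K y z.
Hypothesis K_sum : forall y, \sum_z K y z = 1.

(** The [t]-step transition probability from [y] to [x]. Estimates are made on the kernel through
    [heat] and [hit]; path measures enter only via [law_at_heat] and [prob_hit]. *)
Fixpoint heat (t : nat) (y x : V) : R :=
  if t is t'.+1 then \sum_z K y z * heat t' z x else (y == x)%:R.

(** The probability of a visit to [x] at some time at most [t], time 0 included; stopping at [x]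
    makes it a first-step recursion. *)
Fixpoint hit (x : V) (t : nat) (y : V) : R :=
  if y == x then 1 else
  if t is t'.+1 then \sum_z K y z * hit x t' z else 0.

Lemma heat_ge0 t y x : 0 <= heat t y x.
Proof.
by elim: t y => [|t IH] y /=; [rewrite ler0n | apply: sumr_ge0 => z _; rewrite mulr_ge0].
Qed.

Lemma heatD s t y x : heat (s + t) y x = \sum_z heat s y z * heat t z x.
Proof.
elim: s y => [|s IH] y /=.
  rewrite (bigD1 y)//= eqxx mul1r big1 ?addr0// => z.
  by rewrite eq_sym => /negbTE ->; rewrite mul0r.
under [RHS]eq_bigr do rewrite mulr_suml.
rewrite exchange_big/=; apply: eq_bigr => z _; rewrite IH mulr_sumr.
by apply: eq_bigr => u _; rewrite mulrA.
Qed.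

Lemma hitxx x t : hit x t x = 1.
Proof. by case: t => /=; rewrite eqxx. Qed.

Lemma hit_bounds x t y : 0 <= hit x t y <= 1.
Proof.
elim: t y => [|t IH] y /=; case: ifP => _; rewrite ?ler01 ?lexx//.
apply/andP; split; first by apply: sumr_ge0 => z _; rewrite mulr_ge0//; case/andP: (IH z).
rewrite -(K_sum y); apply: ler_sum => z _; rewrite ler_piMr//.
by case/andP: (IH z).
Qed.

Lemma hit_ge0 x t y : 0 <= hit x t y.
Proof. by case/andP: (hit_bounds x t y). Qed.

Lemma hit_leS x t y : hit x t y <= hit x t.+1 y.
Proof.
elim: t y => [|t IH] y /=; case: eqP => // _.
  by apply: sumr_ge0 => z _; rewrite mulr_ge0//; case: ifP.
apply: ler_sum => z _; rewrite ler_wpM2l//; exact: IH.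
Qed.

Lemma hit_le x y : {homo (fun t => hit x t y) : s t / (s <= t)%N >-> s <= t}.
Proof. by apply: homo_leq => //; [apply: le_trans|move=> t; apply: hit_leS]. Qed.

(* After a visit to [x] at least [\sum_(t < S) heat t x x] further visits are expected. *)
Lemma hit_green x S T y :
  (\sum_(t < S) heat t x x) * hit x T y <= \sum_(t < T + S) heat t y x.
Proof.
elim: T y => [|T IH] y.
  rewrite add0n /=; case: eqP => [->|_]; rewrite ?mulr1// mulr0.
  by apply: sumr_ge0 => t _; apply: heat_ge0.
have [->|yx] := eqVneq y x.
  rewrite hitxx mulr1 [leRHS](_ : _ = \sum_(t < S + T.+1) heat t x x); last by rewrite addnC.
  rewrite big_split_ord/= lerDl; apply: sumr_ge0 => t _; exact: heat_ge0.
rewrite [hit _ _ _]/= (negbTE yx) mulr_sumr addSn big_ord_recl.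
apply: (@le_trans _ _ (\sum_(t < T + S) heat t.+1 y x)); last first.
  by rewrite lerDr heat_ge0.
rewrite /= exchange_big/=; apply: ler_sum => z _.
by rewrite mulrCA -mulr_sumr ler_wpM2l.
Qed.

(** Union bound and Markov property: a visit by time [t0 + T] happens by time [t0], or within [T]
    steps of the position at time [t0]. *)
Lemma hit_split x t0 T y :
  hit x (t0 + T) y <= hit x t0 y + \sum_z heat t0 y z * hit x T z.
Proof.
elim: t0 y => [|t0 IH] y.
  rewrite add0n /= (bigD1 y)//= eqxx mul1r big1 ?addr0.
    by rewrite lerDr; case: ifP.
  by move=> z /negbTE; rewrite eq_sym => ->; rewrite mul0r.
rewrite addSn /=; case: eqP => [_|_].
  rewrite lerDl; apply: sumr_ge0 => z _; rewrite mulr_ge0 ?hit_ge0//.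
  by apply: sumr_ge0 => u _; rewrite mulr_ge0 ?heat_ge0.
under [X in _ + X]eq_bigr do rewrite mulr_suml.
rewrite exchange_big/= -big_split/=; apply: ler_sum => z _.
under eq_bigr do rewrite -mulrA.
by rewrite -mulr_sumr -mulrDr ler_wpM2l.
Qed.

(** Averaging [hit_green] over the position at time [t0] replaces a late hit by the expected visits
    after [t0], where the heat kernel has already decayed. *)
Lemma hit_le_green x S t0 T y : 0 < \sum_(t < S) heat t x x ->
  hit x T y <= hit x t0 y +
    (\sum_(t < T + S) heat (t0 + t) y x) / \sum_(t < S) heat t x x.
Proof.
move=> g0; apply: (le_trans (@hit_le x y T (t0 + T)%N _)); first exact: leq_addl.
apply: (le_trans (hit_split _ _ _ _)); rewrite lerD2l ler_pdivlMr// mulrC mulr_sumr.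
under [leRHS]eq_bigr do rewrite heatD.
rewrite exchange_big/=; apply: ler_sum => z _.
rewrite mulrCA -mulr_sumr ler_wpM2l ?heat_ge0//; exact: hit_green.
Qed.

(* Optional stopping for a nonnegative function whose drift is at most [c]. *)
Lemma hit_drift (f : V -> R) (c : R) x t y :
  (forall z, 0 <= f z) -> (forall z, \sum_u K z u * f u <= f z + c) -> 0 <= c ->
  f x * hit x t y <= f y + c *+ t.
Proof.
move=> f0 fc c0; elim: t y => [|t IH] y /=.
  by rewrite mulr0n addr0; case: eqP => [->|_]; rewrite ?mulr1 ?mulr0.
case: eqP => [->|_]; first by rewrite mulr1 lerDl mulrn_wge0.
rewrite mulr_sumr.
apply: (@le_trans _ _ (\sum_z K y z * (f z + c *+ t))).
  by apply: ler_sum => z _; rewrite mulrCA ler_wpM2l.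
under eq_bigr do rewrite mulrDr.
by rewrite big_split/= -mulr_suml K_sum mul1r mulrS addrA lerD2r.
Qed.

End Chain.

(** * The lazy kernel of a graph *)

Section LazyKernel.
Context {R : realType} {V : finType}.
Variable e : rel V.
Hypothesis deg_gt0 : forall x, (0 < deg e x)%N.

Lemma lazy_kernel_ge0 (y z : V) : 0 <= lazy_kernel e y z :> R.
Proof. by rewrite /lazy_kernel addr_ge0// mulr_ge0 ?invr_ge0// divr_ge0. Qed.

Lemma sum_adj (y : V) (f : V -> R) : \sum_z (e y z)%:R * f z = \sum_(z | e y z) f z.
Proof.
by rewrite [RHS]big_mkcond; apply: eq_bigr => z _; case: (e y z); rewrite ?mul1r ?mul0r.
Qed.

Lemma lazy_kernelE (y : V) (f : V -> R) :
  \sum_z lazy_kernel e y z * f z =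
  2^-1 * f y + 2^-1 * ((\sum_(z | e y z) f z) / (deg e y)%:R).
Proof.
under eq_bigr do rewrite /lazy_kernel mulrDl -!mulrA.
rewrite big_split/= -!mulr_sumr; congr (_ * _ + _ * _).
  rewrite (bigD1 y)//= eqxx mul1r big1 ?addr0// => z.
  by rewrite eq_sym => /negbTE ->; rewrite mul0r.
under [LHS]eq_bigr do rewrite (mulrC _^-1) mulrA.
by rewrite -mulr_suml sum_adj.
Qed.

Lemma lazy_kernel_sum (y : V) : \sum_z lazy_kernel e y z = 1 :> R.
Proof.
under eq_bigr do rewrite -[lazy_kernel _ _ _]mulr1.
rewrite (lazy_kernelE y (fun=> 1)) -(natr_sum _ _ _ (fun=> 1%N)) sum1_card.
by rewrite mulfV ?pnatr_eq0 -?lt0n ?deg_gt0// mulr1; field.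
Qed.

End LazyKernel.

(** * Path measures of the lazy walk and first-step recursions *)

Lemma measure_fin_partition {d : measure_display} {T : measurableType d} {R : realType}
    (P : probability T R) (V : finType) (f : T -> V) (A : set T) :
  (forall v, measurable (f @^-1` [set v])) -> measurable A ->
  P A = (\sum_v P (A `&` f @^-1` [set v]))%E.
Proof.
move=> mf mA.
rewrite -[in LHS](setIT A) -(preimage_setT f).
have -> : [set: V] = \bigcup_(v in [set` index_enum V]) [set v].
  by apply/seteqP; split=> v //= _; exists v => //=; rewrite mem_index_enum.
rewrite preimage_bigcup setI_bigcupr measure_fin_bigcup//.
- by rewrite -(@fsbig_seq _ _ _ V (index_enum V))// index_enum_uniq.
- move=> u v _ _ [w [[_ /= <-] [_ /= ->]]]//.
- by move=> v _; apply: measurableI.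
Qed.

Section LazyWalk.
Context {R : realType} {V : finType} {d : measure_display} {Om : measurableType d}.
Variables (e : rel V) (Q : V -> probability Om R) (Z : nat -> Om -> V).
Hypothesis ZQ : is_lazy_walk e Q Z.
Local Notation K := (lazy_kernel e : V -> V -> R).

Let mZ n v : measurable (Z n @^-1` [set v]) := ZQ.1 n v.

Definition cylinder (s : nat -> V) (n : nat) : set Om :=
  [set w | forall k, (k <= n)%N -> Z k w = s k].

Lemma measurable_cylinder s n : measurable (cylinder s n).
Proof.
rewrite [X in measurable X](_ : _ = \bigcap_(k in [set k | (k <= n)%N]) (Z k @^-1` [set s k])).
  by apply: bigcap_measurable => [|? _]; [exists 0%N|exact: mZ].
by apply/seteqP; split => w /=.
Qed.

Let extend (s : nat -> V) (n : nat) (v : V) (k : nat) : V := if k == n.+1 then v else s k.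

Lemma cylinder_extend s n v :
  cylinder s n `&` Z n.+1 @^-1` [set v] = cylinder (extend s n v) n.+1.
Proof.
apply/seteqP; split => w /=.
  move=> [ws wv] k; rewrite leq_eqVlt /extend; case: eqP => [->//|_ /= kn].
  exact: ws.
move=> ws; split; last by rewrite (ws n.+1)// /extend eqxx.
move=> k kn; rewrite ws ?(leqW kn)// /extend; case: eqP => // kE; lia.
Qed.

Let weight (x : V) (s : nat -> V) (n : nat) : R :=
  (x == s 0%N)%:R * \prod_(k < n) K (s k) (s k.+1).

Lemma weight_extend x s n v :
  weight x (extend s n v) n.+1 = weight x s n * K (s n) v.
Proof.
rewrite /weight big_ord_recr/= mulrA /extend eqxx (ltn_eqF (ltnSn n)) /=; congr (_ * _); congr (_ * _).
by apply: eq_bigr => i _; rewrite !ltn_eqF ?ltnS ?(ltnW (ltn_ord i)).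
Qed.

(* Both the law of the walk and its hitting probabilities solve a first step
   recursion; an event family with the same structure has the same probability. *)
Lemma first_step (E : nat -> nat -> set Om) (f : nat -> V -> R) x :
  (forall n m, measurable (E n m)) ->
  (forall n m s, cylinder s n `&` E n m = cylinder s n /\ f m (s n) = 1 \/
     cylinder s n `&` E n m = set0 /\ f m (s n) = 0 \/
     exists2 m', m = m'.+1 & cylinder s n `&` E n m = cylinder s n `&` E n.+1 m' /\
       f m (s n) = \sum_z K (s n) z * f m' z) ->
  forall m n s, Q x (cylinder s n `&` E n m) = (weight x s n * f m (s n))%:E.
Proof.
move=> mE step; elim=> [|m IH] n s.
  case: (step n 0%N s) => [[-> ->]|[[-> ->]|[m' //]]].
    by rewrite mulr1 /cylinder ZQ.2.
  by rewrite mulr0 measure0.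
case: (step n m.+1 s) => [[-> ->]|[[-> ->]|[_ [<-] [cE fE]]]].
- by rewrite mulr1 /cylinder ZQ.2.
- by rewrite mulr0 measure0.
(* Split by the next position: each piece is a cylinder one step longer, with one step less to
   go. *)
rewrite cE fE (@measure_fin_partition _ _ _ _ _ (Z n.+1))//; last first.
  by apply: measurableI => //; exact: measurable_cylinder.
rewrite mulr_sumr -sumEFin; apply: eq_bigr => v _.
by rewrite setIAC cylinder_extend IH weight_extend /extend eqxx mulrA.
Qed.

(** The cylinders of length 0 partition the space by the starting point, and only the one at [x] has
    mass under [Q x]. *)
Lemma Q_first_step (E : nat -> nat -> set Om) (f : nat -> V -> R) x m :
  (forall n m, measurable (E n m)) ->
  (forall n m s, cylinder s n `&` E n m = cylinder s n /\ f m (s n) = 1 \/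
     cylinder s n `&` E n m = set0 /\ f m (s n) = 0 \/
     exists2 m', m = m'.+1 & cylinder s n `&` E n m = cylinder s n `&` E n.+1 m' /\
       f m (s n) = \sum_z K (s n) z * f m' z) ->
  Q x (E 0%N m) = (f m x)%:E.
Proof.
move=> mE step; rewrite (@measure_fin_partition _ _ _ _ _ (Z 0%N))//.
have cyl v : E 0%N m `&` Z 0%N @^-1` [set v] = cylinder (fun=> v) 0 `&` E 0%N m.
  rewrite setIC; congr (_ `&` _); apply/seteqP; split => w /=.
    by move=> wv [|].
  by move=> /(_ 0%N (leqnn _)).
under eq_bigr do rewrite cyl (first_step x mE step) /weight big_ord0 mulr1.
rewrite sumEFin (bigD1 x)//= eqxx mul1r big1 ?addr0// => v.
by rewrite eq_sym => /negbTE ->; rewrite mul0r.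
Qed.

Lemma law_at_heat t x v : law_at Q Z t x v = heat K t x v.
Proof.
rewrite /law_at.
(* In [E n m], [n] is the current time and [m] the number of steps left; the sum [n + m] stays fixed
   along the recursion. *)
rewrite -[Z t @^-1` _]/((fun n m => Z (n + m)%N @^-1` [set v]) 0%N t).
rewrite (@Q_first_step _ (fun m z => heat K m z v))//.
move=> n [|m] s; rewrite ?addn0/=; last first.
  by right; right; exists m => //; rewrite addSnnS.
have [snv|snv] := eqVneq (s n) v; [left|right; left]; split => //.
  by apply/setIidPl => w ws /=; rewrite ws.
by apply/seteqP; split => // w [ws /= wv]; case/eqP: snv; rewrite -wv ws.
Qed.

Lemma prob_hit x T y :
  Q y [set w | exists2 t, (t <= T)%N & Z t w = x] = (hit K x T y)%:E.
Proof.
rewrite -[X in Q y X]/((fun n m => [set w | exists2 t, (t <= m)%N & Z (n + t)%N w = x]) 0%N T).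
rewrite (@Q_first_step _ (fun m z => hit K x m z))// => [n m|n m s].
  rewrite [X in measurable X](_ : _ = \bigcup_(t in [set t | (t <= m)%N]) (Z (n + t)%N @^-1` [set x])).
    by apply: bigcup_measurable => t _; exact: mZ.
  by apply/seteqP; split => w /= [t ? ?]; exists t.
have [snx|/eqP snx] := eqVneq (s n) x.
  left; rewrite snx hitxx; split => //.
  by apply/setIidPl => w ws; exists 0%N => //; rewrite addn0 ws.
have nox w : cylinder s n w -> Z n w <> x by move=> ws; rewrite ws.
case: m => [|m]; right.
  left; split; last by rewrite /= ifN//; exact/eqP.
  apply/seteqP; split => // w [ws [t]]; rewrite leqn0 => /eqP ->.
  by rewrite addn0; apply: nox.
right; exists m => //; split; last by rewrite /= ifN//; exact/eqP.
apply/seteqP; split => w [ws [[|t]]] tm wx; split => //.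
- by move: wx; rewrite addn0 => /nox; case.
- by exists t => //; rewrite addSnnS.
- by exists 1%N => //; rewrite addnS -addSn.
- by exists t.+2 => //; rewrite -addSnnS.
Qed.

End LazyWalk.

(** * Distance to the origin on the cycle *)

Section Circle.
Variable N : nat.
Hypothesis N_gt1 : (1 < N)%N.

(** The graph distance from [z] to 0 on the cycle of length [N]. *)
Definition cnorm (z : 'Z_N) : nat := minn z (N - z).
Arguments cnorm z%_R.

Lemma Zp_ltn (z : 'Z_N) : (z < N)%N.
Proof. by case: N N_gt1 z => [|[|n]] // _ z; exact: ltn_ord. Qed.

Lemma val_Zp_add1 (z : 'Z_N) : (z + 1 : 'Z_N) = (if z.+1 == N then 0 else z.+1)%N :> nat.
Proof.
case: N N_gt1 z => [|[|n]] // _ z /=.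
have := ltn_ord z; rewrite [X in (_ < X)%N -> _]/= (@modn_small 1)// addn1.
case: eqP => [->|zn] zl; first by rewrite modnn.
by rewrite modn_small//; move: zl zn; rewrite /Zp_trunc/=; lia.
Qed.

Lemma val_Zp_sub1 (z : 'Z_N) : (z - 1 : 'Z_N) = (if z == 0%N :> nat then N.-1 else z.-1)%N :> nat.
Proof.
have := val_Zp_add1 (z - 1); rewrite subrK; have := Zp_ltn (z - 1); have := Zp_ltn z.
move: (nat_of_ord (z - 1)) (nat_of_ord z) => a b.
by case: eqP => [|]; case: eqP; lia.
Qed.

Lemma cnorm_add1 (z : 'Z_N) : (cnorm (z + 1) <= (cnorm z).+1)%N.
Proof. by rewrite /cnorm val_Zp_add1; have := Zp_ltn z; case: eqP; lia. Qed.

Lemma cnorm_sub1 (z : 'Z_N) : (cnorm (z - 1) <= (cnorm z).+1)%N.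
Proof. by rewrite /cnorm val_Zp_sub1; have := Zp_ltn z; case: eqP; lia. Qed.

(** With a = [cnorm z], one neighbour has norm at most |a - 1| and the other at most a + 1; the
    absolute value covers a = 0. Then (a + 1)^2 + (a - 1)^2 = 2 a^2 + 2. Near the antipode of 0 the
    inequality can be strict. *)
Lemma cnorm_sq_drift (z : 'Z_N) :
  (cnorm (z + 1) ^ 2 + cnorm (z - 1) ^ 2 <= 2 * cnorm z ^ 2 + 2)%N.
Proof.
have zN := Zp_ltn z.
have [a ac] : exists a : nat, [/\ (cnorm z = a)%N, (cnorm (z + 1) <= a.+1)%N &
    (cnorm (z - 1) <= `|a%:Z - 1|)%N \/ (cnorm (z + 1) <= `|a%:Z - 1|)%N /\ (cnorm (z - 1) <= a.+1)%N].
  exists (cnorm z); split => //; first exact: cnorm_add1.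
  rewrite /cnorm val_Zp_add1 val_Zp_sub1; case: eqP; case: eqP; lia.
case: ac => -> c1 [c2|[c3 c2]]; rewrite -!mulnn.
  have := leq_mul c1 c1; have := leq_mul c2 c2; case: a {c1 c2} => [|a]; nia.
have := leq_mul c3 c3; have := leq_mul c2 c2; case: a {c1 c2 c3} => [|a]; nia.
Qed.

Lemma cnorm_eq0 (z : 'Z_N) : (cnorm z == 0)%N -> z = 0.
Proof.
move=> /eqP cz; apply/val_inj => /=; have := Zp_ltn z; move: cz; rewrite /cnorm.
by case: N N_gt1 z => [|[|n]] // _ z /=; lia.
Qed.

Lemma cnorm0 : cnorm 0 = 0%N.
Proof. by rewrite /cnorm; case: N N_gt1 => [|[|n]]. Qed.

Lemma cnormN (z : 'Z_N) : cnorm (- z) = cnorm z.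
Proof.
have := Zp_ltn z; rewrite /cnorm.
case: N N_gt1 z => [|[|n]] // _ z /=; rewrite [Zp_trunc _]/= => zn.
case: (posnP z) => [->|z0]; first by rewrite subn0 modnn.
rewrite -[(Zp_trunc n.+2).+2]/(n.+2); move: zn z0.
by move: (nat_of_ord z) => a an a0; rewrite modn_small; lia.
Qed.

Lemma cnorm_descend (z : 'Z_N) : (0 < cnorm z)%N ->
  cnorm (z - 1) = (cnorm z).-1 \/ cnorm (z + 1) = (cnorm z).-1.
Proof.
rewrite /cnorm val_Zp_add1 val_Zp_sub1; have := Zp_ltn z.
by move: (nat_of_ord z) => a; case: eqP; case: eqP; lia.
Qed.

Lemma cnorm_le (z : 'Z_N) : (2 * cnorm z <= N)%N.
Proof. by rewrite /cnorm; have := Zp_ltn z; lia. Qed.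

Lemma card_cnorm_le (k : nat) : (#|[pred z : 'Z_N | cnorm z <= k]| <= k.*2.+1)%N.
Proof.
(* The representatives within [k] of 0 lie at the two ends of the range 0, ..., N - 1. *)
pose s := iota 0 k.+1 ++ iota (N - k) k.
apply: (@leq_trans (size s)); last by rewrite size_cat !size_iota; lia.
rewrite cardE -(size_map (fun z : 'Z_N => z : nat)); apply: uniq_leq_size.
  by rewrite map_inj_uniq ?enum_uniq//; exact: val_inj.
move=> u /mapP[z]; rewrite mem_enum inE => zk ->; rewrite mem_cat !mem_iota.
by have := Zp_ltn z; move: zk; rewrite /cnorm; lia.
Qed.

End Circle.
Arguments cnorm {N} z%_R.

(** * Graph distance and balls on the torus *)

Section TorusMetric.
Context {R : realType}.
Variables d N : nat.
Hypothesis N_gt1 : (1 < N)%N.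
Local Notation V := {ffun 'I_d -> 'Z_N}.
Local Notation adj := (torus_adj d N).
Local Notation e_ := (@unit_vec d N).

Lemma torus_adj_translate (a x y : V) : adj (x + a) (y + a) = adj x y.
Proof.
apply: eq_existsb => i.
by rewrite (addrAC x) (inj_eq (addIr a)) -(addrAC x (- _)) (inj_eq (addIr a)).
Qed.

Lemma joined_by_translate n (a x y : V) : joined_by adj n (x + a) (y + a) -> joined_by adj n x y.
Proof.
case/existsP => p /andP[pp /eqP lp].
pose h (z : V) := z - a; have hx : h (x + a) = x by rewrite /h addrK.
apply/existsP; exists (map_tuple h p); apply/andP; split => /=.
  rewrite -[in path _ x]hx path_map (eq_path (e' := adj))// => u v /=.
  by rewrite torus_adj_translate.
by rewrite -[in last x]hx last_map lp /h addrK.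
Qed.

Lemma gdist_translate (a x y : V) : gdist adj (x + a) (y + a) = gdist adj x y.
Proof.
apply: eq_find => n; apply/idP/idP; first exact: joined_by_translate.
by move=> jxy; apply: (@joined_by_translate _ (- a)); rewrite !addrK.
Qed.

Lemma torus_ball_equiv (l : R) (x y : V) :
  rooted_equiv adj x (gball adj x l) y (gball adj y l).
Proof.
have E v : gdist adj y (v + (y - x)) = gdist adj x v.
  by rewrite -(gdist_translate (y - x) x v) [in RHS]addrCA subrr addr0.
exists (fun v : V => v + (y - x)); split.
- by move=> u v _ _; apply: addIr.
- apply/setP => v; apply/imsetP/idP => [[u]|].
    by rewrite !inE => ux ->; rewrite E.
  by rewrite inE => yv; exists (v - (y - x)); rewrite ?subrK// inE -E subrK.
- by rewrite addrCA subrr addr0.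
- by move=> u v _ _; rewrite torus_adj_translate.
Qed.

Lemma adj_coord (x y : V) (i : 'I_d) : adj x y ->
  [\/ y i = x i, y i = x i + 1 | y i = x i - 1].
Proof.
case/existsP => j; case/orP => /eqP ->; rewrite !ffunE; case: eqP => _; rewrite ?subr0 ?addr0.
- by apply: Or32.
- by apply: Or31.
- by apply: Or33.
- by apply: Or31.
Qed.

(** A step moves each coordinate by at most one, so the graph distance dominates every coordinate
    distance. *)
Lemma path_cnorm (p : seq V) (x : V) (i : 'I_d) : path adj x p ->
  (cnorm (last x p i - x i) <= size p)%N.
Proof.
elim: p x => [|y p IH] x /=; first by rewrite subrr cnorm0.
case/andP => /(@adj_coord _ _ i) xy /IH IHy.
case: xy IHy => -> IHy.
- exact: leqW.
- apply: leq_trans (IHy : (_ < (size p).+1)%N).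
  by rewrite opprD addrA -[in X in (X <= _)%N](subrK 1 (_ - x i)) cnorm_add1.
- apply: leq_trans (IHy : (_ < (size p).+1)%N).
  by rewrite opprB addrCA addrC -[in X in (X <= _)%N](addrK 1 (_ - x i)) cnorm_sub1.
Qed.

(** Greedy path: as long as some coordinate differs, a step towards [y] in it lowers the l1 distance
    by exactly one. *)
Lemma joined_by_cnorm n (x y : V) :
  (\sum_i cnorm (y i - x i) = n)%N -> joined_by adj n x y.
Proof.
elim: n x => [|n IH] x.
  move/eqP; rewrite sum_nat_eq0 => /forallP /= xy.
  apply/existsP; exists [tuple] => /=; apply/eqP/ffunP => i.
  by move: (xy i) => /(cnorm_eq0 N_gt1)/eqP; rewrite subr_eq0 => /eqP.
move=> sn.
have [i ci] : exists i, (0 < cnorm (y i - x i))%N.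
  apply/existsP; rewrite -[X in is_true X]negbK negb_exists; apply/negP => /forallP xy.
  by move: sn; rewrite big1// => i _; apply/eqP; rewrite -leqn0 leqNgt.
have step (z : V) : adj x z -> (forall j, j != i -> z j = x j) ->
    cnorm (y i - z i) = (cnorm (y i - x i)).-1 -> joined_by adj n.+1 x y.
  move=> xz zx zi.
  have /IH/existsP[p /andP[pp lp]] : (\sum_j cnorm (y j - z j) = n)%N.
    rewrite (bigD1 i)//= zi; move: sn; rewrite (bigD1 i)//=.
    under [in X in _ -> X]eq_bigr => j ji do rewrite zx//.
    by lia.
  by apply/existsP; exists [tuple of z :: p]; rewrite /= xz pp.
case: (cnorm_descend N_gt1 ci) => ci'.
- apply: (step (x + e_ i)).
  + by apply/existsP; exists i; rewrite eqxx.
  + by move=> j /negbTE ji; rewrite !ffunE ji addr0.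
  + by rewrite !ffunE eqxx opprD addrA.
- apply: (step (x - e_ i)).
  + by apply/existsP; exists i; rewrite eqxx orbT.
  + by move=> j /negbTE ji; rewrite !ffunE ji subr0.
  + by rewrite !ffunE eqxx opprB addrCA addrC.
Qed.

Lemma card_torus : #|torus d N| = (N ^ d)%N.
Proof. by rewrite card_ffun card_ord card_ord Zp_cast. Qed.

(** [gdist] takes the value N^d when its search fails, so a radius below N^d guarantees that an
    actual path stands behind the distance. *)
Lemma gball_cnorm (l : R) (x y : V) (i : 'I_d) : l < (N ^ d)%:R ->
  y \in gball adj x l -> (cnorm (y i - x i))%:R <= l.
Proof.
rewrite inE => lN xyl; apply: le_trans (xyl); rewrite ler_nat.
have : (gdist adj x y < size (iota 0 #|torus d N|))%N.
  by rewrite size_iota card_torus -(ltr_nat R); apply: le_lt_trans lN.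
rewrite -has_find => /(nth_find 0%N); rewrite -/(gdist adj x y).
have: (gdist adj x y < #|torus d N|)%N.
  by rewrite card_torus -(ltr_nat R); apply: le_lt_trans lN.
move=> gN; rewrite nth_iota// add0n => /existsP[p /andP[pp /eqP lp]].
by have := path_cnorm i pp; rewrite lp size_tuple.
Qed.

Lemma gdist_le_cnorm (x y : V) :
  (\sum_i cnorm (y i - x i) < N ^ d)%N ->
  (gdist adj x y <= \sum_i cnorm (y i - x i))%N.
Proof.
move=> sN; rewrite leqNgt; apply/negP => /(before_find 0%N).
by rewrite nth_iota ?card_torus// add0n joined_by_cnorm.
Qed.

(** The l1 norm is at most d N / 2, hence inside the search range of [gdist]. *)
Lemma sum_cnorm_lt (z : V) : (2 <= d)%N -> (\sum_i cnorm (z i) < N ^ d)%N.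
Proof.
move=> d2; have : (2 * \sum_i cnorm (z i) <= d * N)%N.
  rewrite big_distrr/= -[d in (_ <= d * _)%N]card_ord -sum_nat_const.
  by apply: leq_sum => i _; exact: cnorm_le.
have : (d * N <= N ^ d)%N.
  case: d d2 => [|[|k]] // _; rewrite expnS mulnC leq_mul2l; apply/orP; right.
  by elim: k => [|k IH]; rewrite ?expn1// expnS; nia.
have : (0 < N ^ d)%N by rewrite expn_gt0 ltnW.
by lia.
Qed.

(** Pigeonhole: the graph distance is at most the l1 distance, so some coordinate carries at least a
    fraction 1/d of it. *)
Lemma notin_gball (l : R) (x y : V) : (2 <= d)%N -> 0 < l -> y \notin gball adj x l ->
  exists i, l < d%:R * (cnorm (y i - x i))%:R.
Proof.
move=> d2 l0; rewrite inE -ltNge => lxy.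
apply/existsP; rewrite -[X in is_true X]negbK negb_exists; apply/negP => /forallP xy.
have := lt_le_trans lxy; move=> /(_ (\sum_i cnorm (y i - x i))%:R); rewrite ler_nat.
have := sum_cnorm_lt (y - x) d2; under eq_bigr do rewrite !ffunE.
move=> /gdist_le_cnorm le1 /(_ le1); rewrite ltNge => /negP; apply.
have d0 : 0 < d%:R :> R by rewrite ltr0n; case: d d2.
rewrite -(ler_pM2l d0) natr_sum mulr_sumr.
rewrite -[d in d%:R * l]card_ord mulr_natl -sumr_const.
by apply: ler_sum => i _; rewrite leNgt xy.
Qed.

Lemma card_gball (l : R) (k : nat) (x : V) : l < (N ^ d)%:R -> l < k.+1%:R ->
  (#|gball adj x l| <= k.*2.+1 ^ d)%N.
Proof.
move=> lN lk.
pose B := [pred z : 'Z_N | (cnorm z <= k)%N].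
rewrite -(card_imset _ (addIr (- x))).
apply: (@leq_trans #|ffun_on_mem 'I_d (mem B)|).
  apply: subset_leq_card; apply/fintype.subsetP => _ /imsetP[y yb ->].
  apply/ffun_onP => i; rewrite !ffunE inE -ltnS -(ltr_nat R).
  by apply: le_lt_trans lk; apply: gball_cnorm yb.
rewrite card_ffun_on card_ord.
by case: (posnP d) => [->//|d0]; rewrite leq_exp2r// card_cnorm_le.
Qed.

End TorusMetric.

(** * The lazy kernel on the torus and the drift of the squared distance *)

Section TorusKernel.
Context {R : realType}.
Variables d N : nat.
Hypothesis N_gt2 : (2 < N)%N.
Local Notation V := {ffun 'I_d -> 'Z_N}.
Local Notation adj := (torus_adj d N).
Local Notation e_ := (@unit_vec d N).
Local Notation K := (lazy_kernel adj : torus d N -> torus d N -> R).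
Let N_gt1 : (1 < N)%N := ltnW N_gt2.

(** This separates the neighbours x + e_i and x - e_i, which coincide for N = 2, and so makes the
    degree 2d. *)
Let Zp_1_neqN1 : (1 : 'Z_N) != -1.
Proof.
rewrite -subr_eq0 opprK; apply/eqP => /(congr1 (fun z : 'Z_N => z : nat)).
rewrite val_Zp_add1//.
by case: N N_gt2 => [|[|[|n]]].
Qed.

Lemma sum_torus_adj (y : V) (f : V -> R) :
  \sum_(z | adj y z) f z = \sum_i (f (y + e_ i) + f (y - e_ i)).
Proof.
pose h (p : 'I_d * bool) : V := if p.2 then y + e_ p.1 else y - e_ p.1.
have hE i b k : h (i, b) k = y k + (if b then (k == i)%:R else - (k == i)%:R).
  by case: b; rewrite /h /= 2!ffunE // ffunE.
have N1 : ((1 : 'Z_N) == 0) = false by apply/negbTE/oner_neq0.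
have inj_h : injective h.
  move=> [i b] [j c] /ffunP/(_ i); rewrite !hE eqxx => /addrI.
  have [<-|ij] := eqVneq i j.
    case: b c => [] [] // /eqP; first by rewrite (negbTE Zp_1_neqN1).
    by rewrite eq_sym (negbTE Zp_1_neqN1).
  by case: b c => [] [] /eqP; rewrite /= ?oppr0 ?oppr_eq0 N1.
have adjE : [set z | adj y z]%SET = [set h p | p in [set: 'I_d * bool]]%SET.
  apply/setP => z; rewrite inE; apply/existsP/imsetP => [[i /orP[]/eqP->]|[[i b] _ ->]].
  - by exists (i, true).
  - by exists (i, false).
  - by exists i; rewrite /h; case: b; rewrite eqxx ?orbT.
rewrite -big_set/= adjE big_imset/=; last by move=> p q _ _; exact: inj_h.
rewrite (eq_bigl predT) => [|p]; last by rewrite inE.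
rewrite -(pair_bigA _ (fun i b => f (h (i, b))))/=; apply: eq_bigr => i _.
by rewrite big_bool.
Qed.

Lemma deg_torus (y : V) : deg adj y = d.*2.
Proof.
apply/eqP; rewrite -(eqr_nat R) /deg -sum1_card natr_sum.
rewrite (eq_bigl (adj y))// (sum_torus_adj y (fun=> 1)) sumr_const card_ord.
by rewrite -mulr2n -mulrnA -mul2n.
Qed.

Hypothesis d_gt0 : (0 < d)%N.

Lemma torus_kernelE (y : V) (f : V -> R) :
  \sum_z K y z * f z =
  2^-1 * f y + (4 * d%:R)^-1 * \sum_i (f (y + e_ i) + f (y - e_ i)).
Proof.
have d0 : d%:R != 0 :> R by rewrite pnatr_eq0 -lt0n.
rewrite lazy_kernelE deg_torus sum_torus_adj; congr (_ + _).
by rewrite -mul2n natrM; field.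
Qed.

Lemma torus_kernel_sum (y : V) : \sum_z K y z = 1.
Proof. by apply: lazy_kernel_sum => x; rewrite deg_torus double_gt0. Qed.

Definition cnorm_sq (x z : V) : R := \sum_i (cnorm (z i - x i) ^ 2)%:R.

Lemma cnorm_sq_ge0 x z : 0 <= cnorm_sq x z.
Proof. exact: sumr_ge0. Qed.

(** Each of the [d] coordinates has second difference at most 2, weighted by 1/(4d). *)
Lemma cnorm_sq_kernel (x z : V) : \sum_u K z u * cnorm_sq x u <= cnorm_sq x z + 2^-1.
Proof.
have d0 : 0 < d%:R :> R by rewrite ltr0n.
rewrite torus_kernelE.
have le1 : \sum_i (cnorm_sq x (z + e_ i) + cnorm_sq x (z - e_ i)) <=
    d%:R * (2 * cnorm_sq x z + 2).
  rewrite mulr_natl -[d in _ *+ d]card_ord -sumr_const.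
  apply: ler_sum => i _; rewrite /cnorm_sq (bigD1 i)//= [X in _ + X <= _](bigD1 i)//=.
  rewrite [X in _ <= 2 * X + _](bigD1 i)//= !ffunE eqxx.
  have E (v : V) : (forall j, j != i -> v j = z j) ->
      \sum_(j < d | j != i) (cnorm (v j - x j) ^ 2)%:R =
      \sum_(j < d | j != i) (cnorm (z j - x j) ^ 2)%:R :> R.
    by move=> vz; apply: eq_bigr => j /vz ->.
  rewrite (E (z + e_ i)) => [|j /negbTE ji]; last by rewrite !ffunE ji addr0.
  rewrite (E (z - e_ i)) => [|j /negbTE ji]; last by rewrite !ffunE ji subr0.
  have := cnorm_sq_drift N_gt1 (z i - x i); rewrite -(ler_nat R) !natrD natrM.
  by rewrite (addrAC (z i) 1) (addrAC (z i) (- 1)); lra.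
have : (4 * d%:R)^-1 * \sum_i (cnorm_sq x (z + e_ i) + cnorm_sq x (z - e_ i)) <=
    (4 * d%:R)^-1 * (d%:R * (2 * cnorm_sq x z + 2)).
  by rewrite ler_wpM2l.
rewrite [X in _ <= X -> _](_ : _ = 2^-1 * cnorm_sq x z + 2^-1); last first.
  by field; rewrite gt_eqF.
lra.
Qed.

(** [hit_drift] applied to the squared distance from the starting point [y]: it vanishes at [y], is
    at least (l/d)^2 at [x], and gains at most 1/2 per step on average. *)
Lemma hit_torus_far (l : R) (x y : V) (t : nat) : (2 <= d)%N -> 0 < l ->
  y \notin gball adj x l -> hit K x t y <= d%:R ^+ 2 * t%:R / (2 * l ^+ 2).
Proof.
move=> d2 l0 /(notin_gball N_gt1 d2 l0)[i li].
have := hit_drift (lazy_kernel_ge0 adj) torus_kernel_sum (c := 2^-1) x t y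
  (cnorm_sq_ge0 y) (cnorm_sq_kernel y).
rewrite invr_ge0 ler0n => /(_ isT).
rewrite {2}/cnorm_sq big1 ?add0r => [|j _]; last by rewrite subrr cnorm0.
rewrite ler_pdivlMr ?mulr_gt0 ?exprn_gt0// => le1.
have le2 : l ^+ 2 <= d%:R ^+ 2 * cnorm_sq y x.
  apply: (@le_trans _ _ (d%:R ^+ 2 * (cnorm (x i - y i) ^ 2)%:R)).
    rewrite natrX -exprMn ler_pXn2r ?nnegrE ?mulr_ge0 ?(ltW l0)//.
    by rewrite -(cnormN N_gt1) opprB ltW.
  rewrite ler_wpM2l ?exprn_ge0// /cnorm_sq (bigD1 i)//= lerDl.
  exact: sumr_ge0.
have h0 := hit_ge0 (lazy_kernel_ge0 adj) torus_kernel_sum x t y.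
have le3 : l ^+ 2 * hit K x t y <= d%:R ^+ 2 * (cnorm_sq y x * hit K x t y).
  by rewrite mulrA ler_wpM2r.
have le4 : d%:R ^+ 2 * (cnorm_sq y x * hit K x t y) <= d%:R ^+ 2 * (2^-1 *+ t).
  by rewrite ler_wpM2l ?exprn_ge0.
by move: (le_trans le3 le4); rewrite -mulr_natr; lra.
Qed.

End TorusKernel.

(** * Trigonometric estimates *)

Section Trig.
Context {R : realType}.
Implicit Types x : R.

Lemma sin_MVT (a b : R) : a < b -> exists2 c, a < c < b & sin b - sin a = cos c * (b - a).
Proof.
move=> ab; have [|c cab ->] := @MVT R sin cos a b ab (fun x _ => is_derive_sin x).
  by apply: continuous_subspaceT => x; exact: continuous_sin.
by exists c => //; move: cab; rewrite in_itv.
Qed.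

Lemma sin_le_id x : 0 <= x -> sin x <= x.
Proof.
rewrite le_eqVlt => /predU1P[<-|x0]; first by rewrite sin0.
have [c _] := sin_MVT x0; rewrite sin0 !subr0 => ->.
by rewrite ler_piMl ?cos_le1// ltW.
Qed.

(* By the mean value theorem on either side of [x], a violation would make the
   cosine increase. *)
Lemma jordan_sin x : 0 <= x <= pi / 2 -> 2 / pi * x <= sin x.
Proof.
have pi0 := pi_gt0 R; move=> /andP[]; rewrite le_eqVlt => /predU1P[<-|x0].
  by rewrite sin0 mulr0.
rewrite le_eqVlt => /predU1P[->|xpi].
  rewrite sin_pihalf (_ : 2 / pi * (pi / 2) = 1)//.
  by move: (pi : R) pi0 => p p0; field; rewrite gt_eqF.
have [c1 /andP[c10 c1x]] := sin_MVT x0; rewrite sin0 !subr0 => s1.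
have [c2 /andP[xc2 c2p]] := sin_MVT xpi; rewrite sin_pihalf => s2.
rewrite leNgt; apply/negP => sx.
have lt1 : cos c1 < 2 / pi by rewrite -(ltr_pM2r x0) -s1.
have lt2 : 2 / pi < cos c2.
  rewrite -(@ltr_pM2r _ (pi / 2 - x)) ?subr_gt0// -s2 mulrBr.
  rewrite (_ : 2 / pi * (pi / 2) = 1); first by rewrite ltrD2l ltrN2.
  by move: (pi : R) pi0 => p p0; field; rewrite gt_eqF.
have : cos c2 < cos c1.
  rewrite ltr_cos ?(lt_trans c1x)// in_itv/=; lra.
by move=> /(lt_trans lt2)/(lt_trans lt1); rewrite ltxx.
Qed.

Lemma one_sub_cos x : 1 - cos (2 * x) = 2 * sin x ^+ 2.
Proof. by rewrite mulr_natl cos_mulr2n cos2sin2 mulr2n; ring. Qed.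

Lemma cos_period (n : nat) x : cos (x + 2 * pi * n%:R) = cos x.
Proof.
elim: n => [|n IH]; first by rewrite mulr0 addr0.
by rewrite -(natr1 n) mulrDr addrA mulr1 [2 * pi in X in cos (_ + X)]mulr_natl cosD2pi IH.
Qed.

End Trig.

Section CircleCos.
Context {R : realType}.
Variable N : nat.
Hypothesis N_gt1 : (1 < N)%N.

(** The real part of the character exp(2 pi i z / N). The kernel is symmetric, so cosines suffice
    and everything stays real. *)
Definition circle_cos (z : 'Z_N) : R := cos (2 * (pi * z%:R / N%:R)).

Let N0 : N%:R != 0 :> R.
Proof. by rewrite pnatr_eq0 -lt0n ltnW. Qed.

Let cos_modn (n : nat) : cos (2 * (pi * (n %% N)%:R / N%:R)) = cos (2 * (pi * n%:R / N%:R)) :> R.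
Proof.
rewrite [in RHS](divn_eq n N) -(cos_period (n %/ N)); congr cos.
by rewrite natrD natrM; move: (pi : R) => p; field.
Qed.

Let val_ZpD (a b : 'Z_N) : (a + b)%R = ((a + b) %% N)%N :> nat.
Proof. by case: N N_gt1 a b => [|[|n]]. Qed.

Let val_ZpB (a b : 'Z_N) : (a - b)%R = ((a + (N - b)) %% N)%N :> nat.
Proof. by case: N N_gt1 a b => [|[|n]] // _ a b /=; rewrite modnDmr. Qed.

(** This product formula stands in for the multiplicativity of complex characters, both in the
    eigenvector relation and in the orthogonality. *)
Lemma circle_cosD (a b : 'Z_N) :
  circle_cos (a + b) + circle_cos (a - b) = 2 * circle_cos a * circle_cos b.
Proof.
have E1 : circle_cos (a + b) = cos (2 * (pi * (a + b)%N%:R / N%:R)).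
  rewrite -cos_modn; congr cos; congr (_ * (_ * _ / _)); congr (_%:R).
  exact: val_ZpD.
have E2 : circle_cos (a - b) = cos (2 * (pi * (a + (N - b))%N%:R / N%:R)).
  rewrite -cos_modn; congr cos; congr (_ * (_ * _ / _)); congr (_%:R).
  exact: val_ZpB.
have bN := Zp_ltn N_gt1 b.
rewrite E1 E2 natrD natrD natrB 1?ltnW//.
rewrite (_ : 2 * (pi * (a%:R + b%:R) / N%:R) =
  2 * (pi * a%:R / N%:R) + 2 * (pi * b%:R / N%:R)); last by move: (pi : R) => p; field.
rewrite (_ : 2 * (pi * (a%:R + (N%:R - b%:R)) / N%:R) =
  (2 * (pi * a%:R / N%:R) - 2 * (pi * b%:R / N%:R)) + 2 * pi * 1%:R); last by move: (pi : R) => p; field.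
by rewrite cos_period cosD cosB /circle_cos; ring.
Qed.

Lemma circle_cos_cnorm (z : 'Z_N) :
  circle_cos z = cos (2 * (pi * (cnorm z)%:R / N%:R)).
Proof.
rewrite /cnorm /minn; case: ifP => // _.
rewrite natrB; last by rewrite ltnW ?Zp_ltn.
rewrite /circle_cos -[in LHS]cosN -[in LHS](cos_period 1); congr cos; move: (pi : R) => p; by field.
Qed.

Lemma one_sub_circle_cos (z : 'Z_N) :
  1 - circle_cos z = 2 * sin (pi * (cnorm z)%:R / N%:R) ^+ 2.
Proof. by rewrite circle_cos_cnorm one_sub_cos. Qed.

(** As c = [cnorm z] is at most N/2, the inequality [jordan_sin] applies and gives sin(pi c / N) >=
    2c/N. *)
Lemma circle_cos_ge (z : 'Z_N) : 8 * (cnorm z)%:R ^+ 2 / N%:R ^+ 2 <= 1 - circle_cos z.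
Proof.
have pi0 := pi_gt0 R; have Np : 0 < N%:R :> R by rewrite lt_neqAle eq_sym N0 ler0n.
rewrite one_sub_circle_cos.
have t0 : 0 <= pi * (cnorm z)%:R / N%:R :> R by rewrite divr_ge0// mulr_ge0// ltW.
have := @jordan_sin R (pi * (cnorm z)%:R / N%:R); rewrite t0 /=.
have -> : pi * (cnorm z)%:R / N%:R <= pi / 2 :> R.
  rewrite -mulrA ler_pM2l// ler_pdivrMr// ler_pdivlMl//.
  by have := cnorm_le N_gt1 z; rewrite -(ler_nat R) natrM.
rewrite (_ : 2 / pi * _ = 2 * (cnorm z)%:R / N%:R); last first.
  by move: (pi : R) pi0 => p p0; field; rewrite N0 gt_eqF.
move=> /(_ isT) s1.
have : (2 * (cnorm z)%:R / N%:R) ^+ 2 <= sin (pi * (cnorm z)%:R / N%:R) ^+ 2 :> R.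
  rewrite ler_pXn2r ?nnegrE// ?divr_ge0// ?mulr_ge0//.
  by apply: le_trans s1; rewrite divr_ge0// mulr_ge0.
by rewrite expr_div_n exprMn -mulrA; lra.
Qed.

Lemma circle_cos_le (z : 'Z_N) : 1 - circle_cos z <= 32 * (cnorm z)%:R ^+ 2 / N%:R ^+ 2.
Proof.
have pi0 := pi_gt0 R; have Np : 0 < N%:R :> R by rewrite lt_neqAle eq_sym N0 ler0n.
(* This crude bound produces the constant 32 = 2 * 4^2. *)
have pi4 : pi <= 4 :> R by have := @pihalf_lt2 R; lra.
rewrite one_sub_circle_cos.
have t0 : 0 <= pi * (cnorm z)%:R / N%:R :> R by rewrite divr_ge0// mulr_ge0// ltW.
have tp : pi * (cnorm z)%:R / N%:R <= pi :> R.
  rewrite -mulrA ler_piMr// ?(ltW pi0)// ler_pdivrMr// mul1r ler_nat.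
  by have := cnorm_le N_gt1 z; lia.
have s0 : 0 <= sin (pi * (cnorm z)%:R / N%:R) :> R by rewrite sin_ge0_pi// t0.
have s1 : sin (pi * (cnorm z)%:R / N%:R) <= 4 * (cnorm z)%:R / N%:R :> R.
  by apply: (le_trans (sin_le_id t0)); rewrite -!mulrA ler_wpM2r// divr_ge0.
have : sin (pi * (cnorm z)%:R / N%:R) ^+ 2 <= (4 * (cnorm z)%:R / N%:R) ^+ 2 :> R.
  by rewrite ler_pXn2r ?nnegrE// (le_trans s0).
by rewrite expr_div_n exprMn -mulrA; lra.
Qed.

Lemma circle_cos0 : circle_cos 0 = 1.
Proof. by rewrite circle_cos_cnorm (cnorm0 N_gt1) mulr0 mul0r mulr0 cos0. Qed.

Lemma circle_cos_eq1 (z : 'Z_N) : circle_cos z = 1 -> z = 0.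
Proof.
move=> z1; apply/(cnorm_eq0 N_gt1)/eqP.
have := circle_cos_ge z; rewrite z1 subrr => le0; apply/eqP; rewrite -(eqr_nat R).
rewrite -sqrf_eq0 eq_le sqr_ge0 andbT.
have Np : 0 < N%:R ^+ 2 :> R by rewrite exprn_gt0// lt_neqAle eq_sym N0 ler0n.
by move: le0; rewrite ler_pdivrMr// mul0r; lra.
Qed.

End CircleCos.

(** * Fourier representation of the heat kernel *)

Section TorusFourier.
Context {R : realType}.
Variables d N : nat.
Hypothesis N_gt2 : (2 < N)%N.
Hypothesis d_gt0 : (0 < d)%N.
Local Notation V := {ffun 'I_d -> 'Z_N}.
Local Notation adj := (torus_adj d N).
Local Notation e_ := (@unit_vec d N).
Local Notation K := (lazy_kernel adj : torus d N -> torus d N -> R).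
Local Notation c_ := (@circle_cos R N).
Let N_gt1 : (1 < N)%N := ltnW N_gt2.
Let d0 : d%:R != 0 :> R.
Proof. by rewrite pnatr_eq0 -lt0n. Qed.

Definition zdot (k z : V) : 'Z_N := \sum_i k i * z i.

Lemma zdotDl (k k' z : V) : zdot (k + k') z = zdot k z + zdot k' z.
Proof. by rewrite -big_split; apply: eq_bigr => i _; rewrite ffunE mulrDl. Qed.

Lemma zdotDr (k z z' : V) : zdot k (z + z') = zdot k z + zdot k z'.
Proof. by rewrite -big_split; apply: eq_bigr => i _; rewrite ffunE mulrDr. Qed.

Lemma zdotNr (k z : V) : zdot k (- z) = - zdot k z.
Proof. by rewrite -sumrN; apply: eq_bigr => i _; rewrite ffunE mulrN. Qed.

Lemma zdot_unitr (k : V) i : zdot k (e_ i) = k i.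
Proof.
rewrite /zdot (bigD1 i)//= ffunE eqxx mulr1 big1 ?addr0// => j /negbTE ji.
by rewrite ffunE ji mulr0.
Qed.

Lemma zdot_unitl (z : V) i : zdot (e_ i) z = z i.
Proof.
rewrite /zdot (bigD1 i)//= ffunE eqxx mul1r big1 ?addr0// => j /negbTE ji.
by rewrite ffunE ji mul0r.
Qed.

Definition eigen (k : V) : R := 2^-1 + (2 * d%:R)^-1 * \sum_i c_ (k i).

Lemma kernel_eigen (k x z : V) :
  \sum_u K z u * c_ (zdot k (u - x)) = eigen k * c_ (zdot k (z - x)).
Proof.
rewrite torus_kernelE//.
rewrite (eq_bigr (fun i => 2 * c_ (zdot k (z - x)) * c_ (k i))); last first.
  move=> i _; rewrite (addrAC z (e_ i)) (addrAC z (- e_ i)) !zdotDr !zdotNr zdot_unitr.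
  by rewrite -circle_cosD.
by rewrite -mulr_sumr /eigen; field.
Qed.

Lemma sum_characters (z : V) :
  \sum_(k : V) c_ (zdot k z) = (z == 0)%:R * (N ^ d)%:R.
Proof.
have [->|z0] := eqVneq z 0.
  rewrite (eq_bigr (fun=> 1)) => [|k _]; last first.
    by rewrite /zdot big1 ?circle_cos0// => i _; rewrite ffunE mulr0.
  by rewrite sumr_const (card_torus d N_gt1) mul1r.
rewrite mul0r.
have [i zi] : exists i, z i != 0.
  apply/existsP; apply: contraNT z0 => /existsPn z0; apply/eqP/ffunP => i.
  by rewrite ffunE; apply/eqP; rewrite -[_ == _]negbK.
set S := \sum_k _.
have shift (a : V) : \sum_(k : V) c_ (zdot (k + a) z) = S.
  by rewrite [RHS](reindex (fun k : V => k + a))//=; exists (fun k => k - a) => k _;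
    rewrite ?addrK ?subrK.
(* Adding the shifts of [k] by e_i and by -e_i multiplies the sum by 2 c(z_i); since c(z_i) is not
   1, the sum vanishes. *)
have : S + S = S * (2 * c_ (z i)).
  rewrite -[X in X + _](shift (e_ i)) -[X in _ + X](shift (- e_ i)) -big_split/=.
  rewrite mulr_suml; apply: eq_bigr => k _.
  rewrite !zdotDl (_ : zdot (- e_ i) z = - z i) ?zdot_unitl.
    by rewrite circle_cosD//; ring.
  by rewrite -(zdot_unitl z) /zdot -sumrN; apply: eq_bigr => j _; rewrite ffunE mulNr.
move=> SE; have /eqP : S * (1 - c_ (z i)) = 0 by lra.
rewrite mulf_eq0 => /orP[/eqP//|]; rewrite subr_eq0 => /eqP/esym/(circle_cos_eq1 N_gt1) zi0.
by rewrite zi0 eqxx in zi.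
Qed.

Lemma heat_torusE t (y x : V) :
  heat K t y x = (N ^ d)%:R^-1 * \sum_k eigen k ^+ t * c_ (zdot k (y - x)).
Proof.
elim: t y => [|t IH] y /=.
  under eq_bigr do rewrite expr0 mul1r.
  rewrite sum_characters subr_eq0 mulrC mulfK//.
  by rewrite pnatr_eq0 expn_eq0 negb_and -lt0n (ltnW N_gt1).
under eq_bigr do rewrite IH mulrCA mulr_sumr.
rewrite -mulr_sumr exchange_big/=; congr (_ * _); apply: eq_bigr => k _.
under eq_bigr do rewrite mulrCA.
by rewrite -mulr_sumr kernel_eigen exprSr mulrA.
Qed.

Lemma sum_circle_cos_bounds (k : V) : - d%:R <= \sum_i c_ (k i) <= d%:R.
Proof.
apply/andP; split.
  rewrite -[d in d%:R]card_ord -sumr_const -sumrN.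
  by apply: ler_sum => i _; exact: cos_geN1.
rewrite -[d in d%:R]card_ord -sumr_const.
by apply: ler_sum => i _; exact: cos_le1.
Qed.

Lemma eigen_subE (k : V) : eigen k = 1 - (2 * d%:R)^-1 * \sum_i (1 - c_ (k i)).
Proof. by rewrite sumrB sumr_const card_ord /eigen; field. Qed.

(** Here laziness matters: without negative eigenvalues, powers are monotone and every diagonal term
    is nonnegative. *)
Lemma eigen_ge0 (k : V) : 0 <= eigen k.
Proof.
have /andP[s1 _] := sum_circle_cos_bounds k.
have dp : 0 < d%:R :> R by rewrite ltr0n.
rewrite /eigen (_ : _ + _ = (2 * d%:R)^-1 * (d%:R + \sum_i c_ (k i))); last by field.
rewrite mulr_ge0 ?invr_ge0 ?mulr_ge0//; lra.
Qed.

Lemma eigen0 : eigen 0 = 1.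
Proof.
rewrite eigen_subE big1 ?mulr0 ?subr0// => i _.
by rewrite ffunE circle_cos0// subrr.
Qed.

(** The bound 1 + x <= exp x turns the mean over coordinates into a product, so that the sum over
    [k] factorises into [d] copies of a one-dimensional sum. *)
Lemma eigen_exp_le t (k : V) :
  eigen k ^+ t <= \prod_i expR (- (t%:R / (2 * d%:R) * (1 - c_ (k i)))).
Proof.
rewrite -expR_sum.
apply: (@le_trans _ _ (expR (- ((2 * d%:R)^-1 * \sum_i (1 - c_ (k i)))) ^+ t)).
  rewrite lerXn2r ?nnegrE ?eigen_ge0 ?expR_ge0// eigen_subE.
  exact: expR_ge1Dx.
by rewrite -expRM_natl sumrN -mulr_sumr mulrN mulrA.
Qed.

Definition circle_sum (t : nat) : R :=
  \sum_(z : 'Z_N) expR (- (t%:R / (2 * d%:R) * (1 - c_ z))).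

Lemma sum_eigen_le t : \sum_k eigen k ^+ t <= circle_sum t ^+ d.
Proof.
apply: (@le_trans _ _ (\sum_(k : V) \prod_i expR (- (t%:R / (2 * d%:R) * (1 - c_ (k i)))))).
  by apply: ler_sum => k _; exact: eigen_exp_le.
rewrite -(bigA_distr_bigA (fun (i : 'I_d) z => expR (- (t%:R / (2 * d%:R) * (1 - c_ z)))))/=.
by rewrite prodr_const card_ord.
Qed.

Lemma heat_torus_le t (y x : V) : heat K t y x <= (N ^ d)%:R^-1 * circle_sum t ^+ d.
Proof.
rewrite heat_torusE; apply: ler_wpM2l; first by rewrite invr_ge0.
apply: le_trans (sum_eigen_le t); apply: ler_sum => k _.
by rewrite ler_piMr ?exprn_ge0 ?eigen_ge0// cos_le1.
Qed.

(** The mode [k = 0] is exactly the uniform law; the other modes are bounded by their diagonal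
    values. *)
Lemma heat_torus_sub_le t (y x : V) :
  `|heat K t y x - (N ^ d)%:R^-1| <= (N ^ d)%:R^-1 * (circle_sum t ^+ d - 1).
Proof.
have zdot0 z : zdot 0 z = 0 by rewrite /zdot big1// => i _; rewrite ffunE mul0r.
rewrite heat_torusE (bigD1 (0 : V))//= eigen0 expr1n mul1r zdot0 circle_cos0// mulrDr mulr1.
rewrite addrAC subrr add0r normrM ger0_norm ?invr_ge0//.
apply: ler_wpM2l; first by rewrite invr_ge0.
apply: le_trans (ler_norm_sum _ _ _) _.
have := sum_eigen_le t; rewrite (bigD1 (0 : V))//= eigen0 expr1n -lerBrDl.
apply: le_trans; apply: ler_sum => k _.
rewrite normrM [X in X * _]ger0_norm ?exprn_ge0 ?eigen_ge0//.
by rewrite ler_piMr ?exprn_ge0 ?eigen_ge0// cos_max.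
Qed.

(** Only the (M + 1)^d frequencies with all coordinates in 0, ..., M are kept. For these the
    eigenvalue is at least 1 - u with u = 16 M^2 / N^2, and the hypothesis says t u <= 1/2, so its
    power is at least 1/2. *)
Lemma heat_diag_ge t M (x : V) : (2 * M < N)%N -> 32 * t%:R * M%:R ^+ 2 <= N%:R ^+ 2 :> R ->
  M.+1%:R ^+ d / (2 * (N ^ d)%:R) <= heat K t x x.
Proof.
move=> MN tM.
have zdot0 k : zdot k 0 = 0 by rewrite /zdot big1// => i _; rewrite ffunE mulr0.
rewrite heat_torusE subrr invfM mulrC -mulrA mulrCA ler_wpM2l ?invr_ge0//.
under eq_bigr do rewrite zdot0 circle_cos0// mulr1.
have N2p : 0 < N%:R ^+ 2 :> R by rewrite exprn_gt0// ltr0n; lia.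
have dp : 0 < d%:R :> R by rewrite ltr0n.
pose B := [pred z : 'Z_N | (z <= M)%N].
apply: (@le_trans _ _ (\sum_(k in ffun_on_mem 'I_d (mem B)) (2^-1 : R))).
  rewrite sumr_const -[leRHS]mulr_natr ler_wpM2l ?invr_ge0// card_ffun_on card_ord.
  rewrite -natrX ler_nat leq_exp2r//.
  pose f (i : 'I_M.+1) : 'Z_N := inZp i.
  have fE i : f i = i :> nat.
    by rewrite /= modn_small// Zp_cast//; have := ltn_ord i; lia.
  have f_inj : injective f by move=> i j /(congr1 (@nat_of_ord _)); rewrite !fE => /val_inj.
  rewrite -[X in (X <= _)%N]card_ord -(card_codom f_inj) subset_leq_card//.
  by apply/fintype.subsetP => _ /codomP[i ->]; rewrite inE fE -ltnS.
rewrite [leRHS](bigID (fun k : V => k \in ffun_on B))/= -[leLHS]addr0 lerD//; last first.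
  by apply: sumr_ge0 => k _; rewrite exprn_ge0 ?eigen_ge0.
apply: ler_sum => k /ffun_onP kB.
pose u : R := 16 * M%:R ^+ 2 / N%:R ^+ 2.
have u0 : 0 <= u by rewrite divr_ge0 ?mulr_ge0 ?exprn_ge0// ltW.
have ku : 1 - u <= eigen k.
  rewrite eigen_subE lerD2l lerN2 mulrC ler_pdivrMr ?mulr_gt0//.
  rewrite (_ : u * _ = 32 * M%:R ^+ 2 / N%:R ^+ 2 * d%:R); last first.
    by rewrite /u; field; rewrite pnatr_eq0; lia.
  rewrite (_ : _ * d%:R = \sum_(i < d) 32 * M%:R ^+ 2 / N%:R ^+ 2).
    2: by rewrite sumr_const card_ord mulr_natr.
  apply: ler_sum => i _.
  apply: le_trans (circle_cos_le N_gt1 _) _.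
  rewrite ler_pM2r ?invr_gt0// ler_pM2l// lerXn2r ?nnegrE// ler_nat.
  by have := kB i; rewrite inE; apply: leq_trans; exact: geq_minl.
have [t0|t0] := posnP t; first by rewrite t0 expr0; lra.
have tu : u * t%:R <= 2^-1 by rewrite /u mulrAC ler_pdivrMr//; lra.
have u1 : u <= 1.
  have : 1 <= t%:R :> R by rewrite ler1n.
  by nra.
apply: (@le_trans _ _ ((1 - u) ^+ t)); last by rewrite lerXn2r// nnegrE ?eigen_ge0; lra.
apply: (@le_trans _ _ (1 - u * t%:R)); first lra.
(* Bernoulli's inequality. *)
elim: t {t0 tM tu} => [|t IH]; first by rewrite mulr0 subr0.
have : 0 <= t%:R :> R by [].
rewrite exprS -natr1 => tp.
apply: (@le_trans _ _ ((1 - u) * (1 - u * t%:R))); first nra.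
by rewrite ler_wpM2l//; lra.
Qed.

End TorusFourier.

(** * Upper bounds for the heat kernel *)

Section TorusBounds.
Context {R : realType}.
Variables d N : nat.
Hypothesis N_gt2 : (2 < N)%N.
Hypothesis d_gt0 : (0 < d)%N.
Local Notation V := {ffun 'I_d -> 'Z_N}.
Local Notation adj := (torus_adj d N).
Local Notation K := (lazy_kernel adj : torus d N -> torus d N -> R).
Let N_gt1 : (1 < N)%N := ltnW N_gt2.
Let dp : 0 < d%:R :> R.
Proof. by rewrite ltr0n. Qed.
Let Np : 0 < N%:R :> R.
Proof. by rewrite ltr0n (ltnW N_gt1). Qed.

Lemma expR1_le4 : expR 1 <= 4 :> R.
Proof.
have := expR_ge1Dx (- 2^-1 : R); rewrite expRN => h.
have p := expR_gt0 (2^-1 : R).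
have : expR (2^-1 : R) <= 2.
  rewrite -[leLHS]invrK -[leRHS]invrK lef_pV2 ?posrE ?invr_gt0//; lra.
move=> h2; rewrite (_ : 1 = 2^-1 + 2^-1 :> R); last by field.
by rewrite expRD; nra.
Qed.

Lemma geometric_sum_le (q : R) n : 0 < q < 1 -> \sum_(1 <= j < n) q ^+ j <= q / (1 - q).
Proof.
move=> /andP[q0 q1]; rewrite ler_pdivlMr ?subr_gt0//.
have [n1|n1] := leqP n 1; first by rewrite big_geq// mul0r ltW.
rewrite mulr_suml (eq_bigr (fun j => - (q ^+ j.+1 - q ^+ j))); last first.
  by move=> j _; rewrite exprS; ring.
rewrite sumrN (telescope_sumr (fun j => q ^+ j) (ltnW n1)).
by rewrite opprB lerBlDr lerDl exprn_ge0 ?ltW.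
Qed.

Lemma sum_Zp_neq0 (F : nat -> R) : \sum_(z : 'Z_N | z != 0) F z = \sum_(1 <= j < N) F j.
Proof.
have : \sum_(z : 'Z_N) F z = \sum_(0 <= j < N) F j.
  by case: N N_gt1 => [|[|n]] // _; rewrite big_mkord.
rewrite (bigD1 (0 : 'Z_N))//= [in X in _ = X -> _]big_ltn ?(ltnW N_gt1)//.
by move/addrI.
Qed.

(* [4 r^2 c^2 >= 4 r c - 1] replaces the Gaussian sum by two geometric ones. *)
Lemma circle_sum_le (r : R) t : 0 < r -> r ^+ 2 * d%:R * N%:R ^+ 2 <= t%:R ->
  circle_sum d N t <= 1 + 2 / r.
Proof.
move=> r0 rt; pose q : R := expR (- (4 * r)).
have q0 : 0 < q by exact: expR_gt0.
have q1 : q < 1 by rewrite /q -[ltRHS]expR0 ltr_expR oppr_lt0 mulr_gt0.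
(* [cnorm z] is [z] or [N - z]; keeping both powers removes the minimum and leaves two equal
   geometric sums. *)
have term (z : 'Z_N) : z != 0 :> nat ->
    expR (- (t%:R / (2 * d%:R) * (1 - @circle_cos R N z))) <= 4 * (q ^+ z + q ^+ (N - z)).
  move=> z0; apply: (@le_trans _ _ (4 * q ^+ cnorm z)); last first.
    rewrite ler_pM2l// /cnorm /minn; case: ifP => _; rewrite ?lerDl ?lerDr exprn_ge0// ltW//.
  apply: (@le_trans _ _ (expR 1 * q ^+ cnorm z)); last first.
    by rewrite ler_wpM2r ?expR1_le4// exprn_ge0 ?ltW.
  rewrite /q -expRM_natl -expRD ler_expR.
  have := circle_cos_ge (R := R) N_gt1 z; set u := 1 - _; set c : R := (cnorm z)%:R.
  move=> uc.
  have le1 : t%:R / (2 * d%:R) * (8 * c ^+ 2 / N%:R ^+ 2) <= t%:R / (2 * d%:R) * u.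
    by rewrite ler_wpM2l// divr_ge0// mulr_ge0.
  have le2 : 4 * r ^+ 2 * c ^+ 2 <= t%:R / (2 * d%:R) * (8 * c ^+ 2 / N%:R ^+ 2).
    rewrite [leRHS](_ : _ = 4 * c ^+ 2 * (t%:R / (d%:R * N%:R ^+ 2))).
      rewrite mulrAC ler_wpM2l ?mulr_ge0 ?sqr_ge0// ler_pdivlMr ?mulr_gt0 ?exprn_gt0//.
      by rewrite mulrA.
    by field; rewrite !gt_eqF.
  have : 0 <= (2 * r * c - 1) ^+ 2 by apply: sqr_ge0.
  by move: le1 le2; rewrite !expr2; lra.
rewrite /circle_sum (bigD1 (0 : 'Z_N))//= circle_cos0// subrr mulr0 oppr0 expR0 lerD2l.
apply: (@le_trans _ _ (\sum_(z : 'Z_N | z != 0) 4 * (q ^+ z + q ^+ (N - z)))).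
  by apply: ler_sum => z z0; apply: term; apply: contra z0 => /eqP z0; apply/eqP/val_inj.
rewrite (sum_Zp_neq0 (fun j => 4 * (q ^+ j + q ^+ (N - j)))).
rewrite -mulr_sumr big_split/=.
have -> : \sum_(1 <= j < N) q ^+ (N - j) = \sum_(1 <= j < N) q ^+ j.
  rewrite big_nat_rev/= big_nat_cond [RHS]big_nat_cond; apply: eq_bigr => j /andP[/andP[j1 jN] _].
  by congr (_ ^+ _); lia.
have gs := @geometric_sum_le q N; rewrite q0 q1 in gs; move: (gs isT) => {}gs.
(* q/(1 - q) = 1/(exp(4r) - 1). Two sums with factor 4 then give 8/(4r) = 2/r. *)
have : q / (1 - q) <= (4 * r)^-1.
  rewrite ler_pdivrMr ?subr_gt0// ler_pdivlMl ?mulr_gt0//.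
  have := expR_ge1Dx (4 * r); rewrite -(ler_pM2r q0) -expRD subrr expR0; lra.
rewrite invfM; have : 0 < r^-1 by rewrite invr_gt0.
lra.
Qed.

Lemma heat_torus_le_power (v : R) t (y x : V) : 0 < v -> 4 * d%:R <= v ^+ 2 * t%:R ->
  heat K t y x <= (N%:R^-1 + v) ^+ d.
Proof.
move=> v0 vt; apply: le_trans (heat_torus_le N_gt2 d_gt0 t y x) _.
rewrite natrX -exprVn -exprMn lerXn2r ?nnegrE//.
- rewrite mulr_ge0 ?invr_ge0//; apply: sumr_ge0 => z _; exact: expR_ge0.
- by rewrite addr_ge0 ?invr_ge0// ltW.
(* With r = 2/(vN), the bound (1 + 2/r)/N is 1/N + v, and the condition on [t] becomes 4d <= v^2
   t. *)
have := @circle_sum_le (2 / (v * N%:R)) t; rewrite divr_gt0 ?mulr_gt0// => /(_ isT).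
rewrite (_ : _ * d%:R * _ = 4 * d%:R / v ^+ 2); last by field; rewrite !gt_eqF.
rewrite ler_pdivrMr ?exprn_gt0// [t%:R * _]mulrC => /(_ vt).
move=> cs; apply: (@le_trans _ _ (N%:R^-1 * (1 + 2 / (2 / (v * N%:R))))).
  by rewrite ler_wpM2l ?invr_ge0.
rewrite (_ : _ * (1 + _) = N%:R^-1 + v)//.
by field; rewrite !gt_eqF.
Qed.

End TorusBounds.

(** * Mixing time of the torus *)

Section TorusMixing.
Context {R : realType}.
Variables d N : nat.
Hypothesis N_gt2 : (2 < N)%N.
Hypothesis d_gt0 : (0 < d)%N.
Local Notation adj := (torus_adj d N).
Local Notation K := (lazy_kernel adj : torus d N -> torus d N -> R).
Let N_gt1 : (1 < N)%N := ltnW N_gt2.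
Let Nd0 : (N ^ d)%:R != 0 :> R.
Proof. by rewrite pnatr_eq0 expn_eq0 negb_and -lt0n (ltnW N_gt1). Qed.

Lemma stationary_torus (v : torus d N) : stationary_law adj v = (N ^ d)%:R^-1 :> R.
Proof.
rewrite /stationary_law deg_torus// (eq_bigr (fun=> d.*2)) => [|z _]; last exact: deg_torus.
rewrite sum_nat_const card_torus// natrM; field; rewrite Nd0 /=.
by rewrite pnatr_eq0 double_eq0 -lt0n.
Qed.

Lemma tv_torus_le (t : nat) (x : torus d N) : (256 * d ^ 3 * N ^ 2 <= t)%N ->
  Defs.total_variation (heat K t x) (stationary_law adj) <= 4^-1.
Proof.
move=> tN; have dp : 0 < d%:R :> R by rewrite ltr0n.
have NP : 0 < N%:R :> R by rewrite ltr0n (ltnW N_gt1).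
apply: bigmax_le => [|A _]; first by rewrite invr_ge0.
(* Taking r = 16d yields the time 256 d^3 N^2; the d-th power of the sum is then at most exp(1/8) <=
   8/7 < 5/4. *)
have cs : circle_sum d N t <= 1 + (8 * d%:R)^-1 :> R.
  rewrite (_ : (8 * d%:R)^-1 = 2 / (16 * d%:R)); last by field; rewrite gt_eqF.
  apply: circle_sum_le; rewrite ?mulr_gt0//.
  move: tN; rewrite -(ler_nat R) 2!natrM !natrX; apply: le_trans.
  by rewrite [leRHS](_ : _ = (16 * d%:R) ^+ 2 * d%:R * N%:R ^+ 2)//; ring.
have cs0 : 0 <= circle_sum d N t :> R.
  by apply: sumr_ge0 => z _; exact: expR_ge0.
have cs1 : circle_sum d N t ^+ d <= 1 + 4^-1 :> R.
  apply: (@le_trans _ _ (expR (8 * d%:R)^-1 ^+ d)).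
    rewrite lerXn2r ?nnegrE ?expR_ge0//; apply: (le_trans cs); exact: expR_ge1Dx.
  rewrite -expRM_natl (_ : d%:R * (8 * d%:R)^-1 = 8^-1); last by field; rewrite gt_eqF.
  have := expR_ge1Dx (- 8^-1 : R); have p0 := expR_gt0 (8^-1 : R).
  rewrite -(ler_pM2r p0) -expRD (addrC (- _)) subrr expR0; lra.
rewrite -sumrB; apply: le_trans (ler_norm_sum _ _ _) _.
apply: (@le_trans _ _ (\sum_(v : torus d N) (N ^ d)%:R^-1 * 4^-1)).
  rewrite [leRHS](bigID (fun v => v \in A))/= -[leLHS]addr0 lerD//.
    apply: ler_sum => v _; rewrite stationary_torus.
    apply: le_trans (heat_torus_sub_le N_gt2 d_gt0 t x v) _.
    by rewrite ler_wpM2l ?invr_ge0//; lra.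
  by apply: sumr_ge0 => v _; rewrite mulr_ge0 ?invr_ge0.
by rewrite sumr_const card_torus// -[leLHS]mulr_natr mulrAC mulVf// mul1r.
Qed.

Lemma mixing_time_torus_le {disp : measure_display} {Om : measurableType disp}
    (Q : torus d N -> probability Om R) (Z : nat -> Om -> torus d N) :
  is_lazy_walk adj Q Z ->
  (mixing_time adj Q Z <= (256 * d ^ 3 * N ^ 2)%:R%:E)%E.
Proof.
move=> ZQ; apply: ereal_inf_lbound; exists (256 * d ^ 3 * N ^ 2)%N => //=.
apply: bigmax_le => [|x _]; first by rewrite invr_ge0.
rewrite (_ : law_at Q Z _ x = heat K (256 * d ^ 3 * N ^ 2) x); first exact: tv_torus_le.
by apply/funext => v; exact: law_at_heat.
Qed.

End TorusMixing.

(** * Hitting estimate in dimension at least three *)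

Section SqrtSum.
Context {R : realType}.

(** With a^2 = t and b^2 = t + 1 this is a telescoping form of the integral comparison for t^(-3/2):
    1/a - 1/b = 1/(ab(a + b)) >= 1/(2b^3). *)
Lemma inv_cube_le (a b : R) : 0 < a -> 0 < b -> b ^+ 2 = a ^+ 2 + 1 ->
  b ^- 3 <= 2 * (a^-1 - b^-1).
Proof.
move=> a0 b0 ab.
have lt_ab : a < b by rewrite -(ltr_pXn2r (n := 2)) ?nnegrE ?ltW// ab ltrDl.
rewrite (_ : a^-1 - b^-1 = (a * b * (a + b))^-1); last first.
  have ba : b - a = (a + b)^-1.
    by apply: (mulIf (x := a + b)); rewrite ?mulVf ?gt_eqF ?addr_gt0//; lra.
  rewrite !invfM -ba; field; rewrite !gt_eqF//.
rewrite (_ : b ^- 3 = 2 * (2 * b ^+ 3)^-1); last by field; rewrite gt_eqF.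
rewrite ler_pM2l// lef_pV2 ?posrE ?mulr_gt0 ?exprn_gt0 ?addr_gt0//.
have : 0 < b * (b - a) by rewrite mulr_gt0 ?subr_gt0.
by nra.
Qed.

Lemma sum_inv_cube_le (p n : nat) : (0 < p)%N ->
  \sum_(t < n) (Num.sqrt (p.+1 + t)%:R) ^- 3 <= 2 * (Num.sqrt p%:R)^-1 :> R.
Proof.
move=> p0.
pose f t : R := - (Num.sqrt (p + t)%:R)^-1.
apply: (@le_trans _ _ (\sum_(0 <= t < n) 2 * (f t.+1 - f t))).
  rewrite big_mkord; apply: ler_sum => t _; rewrite /f opprK (addrC (- _)) addnS -addSn.
  apply: inv_cube_le; rewrite ?sqrtr_gt0 ?ltr0n ?addn_gt0 ?p0// !sqr_sqrtr//.
  by rewrite addSn -natr1.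
rewrite -mulr_sumr ler_pM2l// telescope_sumr// /f opprK addn0.
by rewrite gerDr oppr_le0 invr_ge0 sqrtr_ge0.
Qed.

End SqrtSum.

Section TorusHit.
Context {R : realType}.
Variables d N : nat.
Hypothesis N_gt2 : (2 < N)%N.
Local Notation adj := (torus_adj d N).
Local Notation K := (lazy_kernel adj : torus d N -> torus d N -> R).
Let N_gt1 : (1 < N)%N := ltnW N_gt2.
Let Np : 0 < N%:R :> R.
Proof. by rewrite ltr0n (ltnW N_gt1). Qed.

Lemma cubeD_le (a b : R) : 0 <= a -> 0 <= b -> (a + b) ^+ 3 <= 4 * (a ^+ 3 + b ^+ 3).
Proof.
move=> a0 b0; rewrite -subr_ge0.
rewrite (_ : _ - _ = 3 * ((a + b) * (a - b) ^+ 2)); last by ring.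
by rewrite mulr_ge0// mulr_ge0 ?addr_ge0 ?sqr_ge0.
Qed.

(** Take v = 2 sqrt(d/t). For t >= 16d both v and 1/N are at most 1/2, so the base 1/N + v is at
    most 1 and the exponent [d] may be lowered to 3: the summable rate t^(-3/2) is all that is
    kept. *)
Lemma heat_torus_le3 (t : nat) (x y : torus d N) : (3 <= d)%N -> (16 * d <= t)%N ->
  heat K t y x <= 4 * N%:R ^- 3 + 32 * d%:R ^+ 2 * (Num.sqrt t%:R) ^- 3.
Proof.
move=> d3 td; have d_gt0 : (0 < d)%N := ltnW (ltnW d3).
have t0 : (0 < t)%N by apply: leq_trans td; rewrite muln_gt0.
set b : R := Num.sqrt t%:R.
have b0 : 0 < b by rewrite sqrtr_gt0 ltr0n.
have b2 : b ^+ 2 = t%:R by rewrite sqr_sqrtr.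
set c : R := Num.sqrt d%:R.
have c2 : c ^+ 2 = d%:R by rewrite sqr_sqrtr.
have c1 : 1 <= c by rewrite -sqrtr1 ler_wsqrtr// ler1n.
have c0 : 0 < c := lt_le_trans ltr01 c1.
have v0 : 0 < 2 * c / b by rewrite divr_gt0 ?mulr_gt0.
have v2 : (2 * c / b) ^+ 2 * t%:R = 4 * d%:R.
  by rewrite -b2 -c2; field; rewrite gt_eqF.
have v1 : 2 * c / b <= 2^-1.
  rewrite ler_pdivrMr// -(ler_pXn2r (n := 2)) ?nnegrE ?mulr_ge0 ?invr_ge0 ?(ltW b0) ?(ltW c0)//.
  rewrite !exprMn b2 c2 exprVn ler_pdivlMl ?exprn_gt0//; move: td; rewrite -(ler_nat R) natrM; lra.
apply: (le_trans (heat_torus_le_power N_gt2 d_gt0 (t := t) y x v0 _)); first by rewrite v2.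
have Ni : 0 < N%:R^-1 :> R by rewrite invr_gt0.
have N1 : N%:R^-1 <= 2^-1 :> R by rewrite lef_pV2 ?posrE// ler_nat ltnW.
apply: (@le_trans _ _ ((N%:R^-1 + 2 * c / b) ^+ 3)).
  rewrite ler_wiXn2l//; first by rewrite addr_ge0// ltW.
  by apply: (le_trans (lerD N1 v1)); lra.
apply: (le_trans (cubeD_le (ltW Ni) (ltW v0))); rewrite mulrDr exprVn lerD2l.
rewrite (_ : (2 * c / b) ^+ 3 = 8 * (d%:R * c) * b ^- 3); last first.
  by rewrite -c2; field; rewrite gt_eqF.
rewrite !mulrA ler_wpM2r ?invr_ge0 ?exprn_ge0 ?(ltW b0)//.
rewrite -c2; have := ler_wpM2l (exprn_ge0 3 (ltW c0)) c1.
rewrite mulr1; lra.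
Qed.

Lemma sum_heat_torus_le3 (p n : nat) (x y : torus d N) : (3 <= d)%N -> (16 * d <= p)%N ->
  \sum_(t < n) heat K (p.+1 + t) y x <=
  4 * n%:R * N%:R ^- 3 + 64 * d%:R ^+ 2 * (Num.sqrt p%:R)^-1.
Proof.
move=> d3 pd; have p0 : (0 < p)%N.
  by apply: leq_trans pd; rewrite muln_gt0 (ltnW (ltnW d3)).
apply: (@le_trans _ _ (\sum_(t < n)
    (4 * N%:R ^- 3 + 32 * d%:R ^+ 2 * (Num.sqrt (p.+1 + t)%:R) ^- 3))).
  apply: ler_sum => t _; apply: heat_torus_le3 => //.
  by apply: (leq_trans pd); rewrite addSn ltnW// ltnS leq_addr.
rewrite big_split/= -[X in _ + X]mulr_sumr sumr_const card_ord lerD//.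
  by rewrite -[leLHS]mulr_natr mulrAC.
rewrite (_ : 64 * _ * _ = 32 * d%:R ^+ 2 * (2 * (Num.sqrt p%:R)^-1)); last by ring.
by rewrite ler_wpM2l ?mulr_ge0 ?sqr_ge0//; exact: sum_inv_cube_le.
Qed.

(** Here w = N^(1/4), and radius and cut time are both about w^2. A hit before the cut costs
    O(w^-2), the late visits cost T/N^3 = O(w^-2) plus O(1/w) from the sum of t^(-3/2). The horizon
    w^10 = N^2 w^2 leaves room for the factor (ln N)^2. *)
Lemma hit_far_ge3 (C w : R) (x y : torus d N) (T : nat) : (3 <= d)%N ->
  0 <= C -> 2 <= w -> 16 * d%:R + 1 <= w ^+ 2 -> w ^+ 4 = N%:R ->
  T%:R <= C * w ^+ 10 -> y \notin gball adj x (w ^+ 2) ->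
  hit K x T y <= (129 * d%:R ^+ 2 + 4 * C + 4) / w.
Proof.
move=> d3 C0 w2 wd wN Tw yx.
have d_gt0 : (0 < d)%N := ltnW (ltnW d3).
have w0 : 0 < w := lt_le_trans (ltr0n R 2) w2.
have w1 : 1 <= w by apply: le_trans w2; rewrite ler1n.
have wX0 n : 0 < w ^+ n by rewrite exprn_gt0.
have wX m n : (m <= n)%N -> w ^+ m <= w ^+ n by move=> ?; rewrite ler_weXn2l.
have w1inv : w^-1 <= 1 by rewrite invf_le1.
pose p := Num.truncn (w ^+ 2).
have /andP[p1 p2] : p%:R <= w ^+ 2 < p.+1%:R by apply: truncn_itv; rewrite ltW.
have pd : (16 * d <= p)%N.
  by rewrite -ltnS -(ltr_nat R); apply: le_lt_trans p2; rewrite natrM; lra.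
have K0 := lazy_kernel_ge0 (R := R) adj.
have K1 := torus_kernel_sum (R := R) N_gt2 d_gt0.
(* Only the visit at time 0 is counted in the Green function. *)
have gE : \sum_(t < 1) heat K t x x = 1 by rewrite big_ord1 /= eqxx.
have := hit_le_green (K := K) K0 K1 p.+1 T y (x := x) (S := 1).
rewrite gE divr1 => /(_ ltr01) le0.
have near : hit K x p.+1 y <= d%:R ^+ 2 / w.
  apply: (le_trans (hit_torus_far N_gt2 d_gt0 _ (ltnW d3) (wX0 2%N) yx)).
  rewrite -exprM ler_pdivrMr ?mulr_gt0 ?wX0// -[leRHS]mulrA ler_wpM2l ?sqr_ge0//.
  rewrite (_ : w^-1 * _ = w ^+ 3 + w ^+ 3); last by field; rewrite gt_eqF.
  rewrite -natr1 lerD ?(le_trans p1) ?wX//; exact: exprn_ege1.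
have sqp : (Num.sqrt p%:R)^-1 <= 2 / w :> R.
  rewrite -[leRHS]invrK invfM invrK lef_pV2 ?posrE ?sqrtr_gt0 ?mulr_gt0 ?ltr0n//; last first.
    by apply: leq_trans pd; rewrite muln_gt0.
  rewrite -(ger0_norm (ltW w0)) -sqrtr_sqr -[2^-1]ger0_norm// -sqrtr_sqr -sqrtrM ?sqr_ge0//.
  rewrite ler_wsqrtr//; move: p2; rewrite -natr1 => {}p2.
  move: p2 w2 (ler_wpM2l (ltW w0) w2); rewrite !expr2; lra.
apply: (le_trans le0).
rewrite (_ : _ / w = d%:R ^+ 2 / w +
  ((4 * C + 4) / w + 128 * d%:R ^+ 2 / w)); last by ring.
rewrite lerD//; apply: (le_trans (sum_heat_torus_le3 _ _ _ d3 pd)); rewrite lerD//.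
  rewrite -wN -exprM ler_pdivrMr// mulrAC ler_pdivlMr// natrD mulrDr mulr1 mulrDl.
  rewrite [leRHS]mulrDl lerD//; last by rewrite ler_pM2l// -[leLHS]expr1 wX.
  apply: (@le_trans _ _ (4 * (C * w ^+ 10) * w)).
    by rewrite ler_pM2r// ler_pM2l.
  by rewrite -mulrA -[_ * _ * w]mulrA -exprSr mulrA ler_wpM2l ?wX// mulr_ge0.
rewrite (_ : _ / w = 64 * d%:R ^+ 2 * (2 / w)); last by ring.
by rewrite ler_wpM2l ?mulr_ge0 ?sqr_ge0.
Qed.

End TorusHit.

(** * Hitting estimate in dimension two *)

Section TorusHit2.
Context {R : realType}.
Variable N : nat.
Hypothesis N_gt2 : (2 < N)%N.
Local Notation adj := (torus_adj 2 N).
Local Notation K := (lazy_kernel adj : torus 2 N -> torus 2 N -> R).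
Let N_gt1 : (1 < N)%N := ltnW N_gt2.
Let Np : 0 < N%:R :> R.
Proof. by rewrite ltr0n (ltnW N_gt1). Qed.

Lemma heat_torus_le2 (t : nat) (x y : torus 2 N) : (0 < t)%N ->
  heat K t y x <= 2 * N%:R ^- 2 + 16 * t%:R^-1.
Proof.
move=> t0; have tp : 0 < t%:R :> R by rewrite ltr0n.
set v : R := Num.sqrt (8 / t%:R).
have v0 : 0 < v by rewrite sqrtr_gt0 divr_gt0.
have v2 : v ^+ 2 = 8 / t%:R by rewrite sqr_sqrtr// divr_ge0 ?ltW.
apply: (le_trans (heat_torus_le_power N_gt2 (isT : (0 < 2)%N) (t := t) y x v0 _)).
  by rewrite v2 divfK ?gt_eqF// -natrM.
rewrite -exprVn (_ : 16 * t%:R^-1 = 2 * v ^+ 2); last by rewrite v2; ring.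
rewrite -subr_ge0 (_ : _ - _ = (N%:R^-1 - v) ^+ 2) ?sqr_ge0//; ring.
Qed.

Lemma heat_diag_ge2 (t : nat) (x : torus 2 N) : (0 < t)%N -> (64 * t%:R)^-1 <= heat K t x x.
Proof.
move=> t0; have tp : 0 < t%:R :> R by rewrite ltr0n.
(* The largest [M] allowed in [heat_diag_ge] satisfies (M + 1)^2 > N^2/(32t), whence the bound
   1/(64t). *)
have ex : exists M, (32 * t * M ^ 2 <= N ^ 2)%N by exists 0%N; rewrite muln0.
have bnd M : (32 * t * M ^ 2 <= N ^ 2)%N -> (M <= N)%N.
  move=> MN; rewrite -(leq_sqr M N); apply: leq_trans MN; rewrite leq_pmull//.
  by rewrite muln_gt0.
case: (ex_maxnP ex bnd) => M MN Mmax.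
have {Mmax} M1 : (N ^ 2 < 32 * t * M.+1 ^ 2)%N.
  by rewrite ltnNge; apply/negP => /Mmax; rewrite ltnn.
apply: (le_trans _ (heat_diag_ge (M := M) N_gt2 (isT : (0 < 2)%N) x _ _)); first last.
- by move: MN; rewrite -(ler_nat R) natrM (natrM _ 32) !natrX.
- case: (posnP M) => [->|M0]; first by rewrite muln0 (ltnW N_gt1).
  rewrite -ltn_sqr expnMn; apply: leq_trans MN.
  by rewrite ltn_pmul2r ?expn_gt0 ?M0//; lia.
have Nd : 0 < (N ^ 2)%:R :> R by rewrite ltr0n expn_gt0 (ltnW N_gt1).
rewrite ler_pdivlMr ?mulr_gt0// ler_pdivrMl ?mulr_gt0//.
by move: M1; rewrite -(ltr_nat R) natrM natrM natrX; lra.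
Qed.

Lemma ln_le_harmonic n : (0 < n)%N -> ln (n%:R : R) <= \sum_(1 <= t < n) t%:R^-1.
Proof.
elim: n => // -[_ _|n /(_ isT) IH _]; first by rewrite ln1 big_geq.
have np : 0 < n.+1%:R :> R by rewrite ltr0n.
rewrite big_nat_recr//=; apply: le_trans (lerD IH (lexx _)).
rewrite -lerBlDl -ln_div ?posrE ?ltr0n// -[n.+2%:R]natr1 mulrDl mulfV ?gt_eqF// mul1r.
by apply: le_ln1Dx; rewrite (lt_trans (ltrN10 R))// invr_gt0.
Qed.

Lemma green_torus2 (x : torus 2 N) : ln N%:R / 64 <= \sum_(t < N) heat K t x x.
Proof.
rewrite -(big_mkord xpredT (fun t => heat K t x x)) (big_ltn (ltnW N_gt1)).
apply: (@le_trans _ _ (\sum_(1 <= t < N) heat K t x x)); last first.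
  by rewrite lerDr heat_ge0//; exact: lazy_kernel_ge0.
apply: (@le_trans _ _ (\sum_(1 <= t < N) (64 * t%:R)^-1)); last first.
  by apply: ler_sum_nat => t /andP[t1 _]; exact: heat_diag_ge2.
under eq_bigr do rewrite invfM.
by rewrite -mulr_sumr mulrC ler_pM2l ?invr_gt0// ln_le_harmonic// (ltnW N_gt1).
Qed.

Lemma sum_ltn (m n : nat) : (\sum_(t < n) (t < m) = minn n m)%N.
Proof.
elim: n => [|n IH]; first by rewrite big_ord0 min0n.
by rewrite big_ord_recr/= IH; case: ltnP; lia.
Qed.

(** At the cut N^2/a^3, an earlier hit costs t0/ell^2 = O(1/a); afterwards O(a^3) visits are
    expected, to be divided by a Green function of at least a^4/64. *)
Lemma hit_far_2 (B a : R) (x y : torus 2 N) (T : nat) :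
  0 <= B -> 1 <= a -> a ^+ 4 = ln N%:R ->
  T%:R <= B * a * N%:R ^+ 2 -> y \notin gball adj x (N%:R / a) ->
  hit K x T y <= (4 + 64 * (18 * B + 34)) / a.
Proof.
move=> B0 a1 aN TN yx.
have a0 : 0 < a := lt_le_trans ltr01 a1.
have aX m n : (m <= n)%N -> a ^+ m <= a ^+ n by move=> ?; rewrite ler_weXn2l.
have aX0 n : 0 < a ^+ n by rewrite exprn_gt0.
have N2p : 0 < N%:R ^+ 2 :> R by rewrite exprn_gt0.
have N1 : 1 <= N%:R :> R by rewrite ler1n (ltnW N_gt1).
(* So the cut N^2/a^3 is at least 1, and rounding it up to [p.+1] at most doubles it. *)
have a3N : a ^+ 3 <= N%:R ^+ 2.
  apply: (le_trans (aX 3 4 isT)); rewrite aN.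
  apply: (@le_trans _ _ N%:R); last by rewrite expr2 ler_peMl.
  exact: ltW (ln_sublinear Np).
pose p := Num.truncn (N%:R ^+ 2 / a ^+ 3).
have /andP[p1 p2] : p%:R <= N%:R ^+ 2 / a ^+ 3 < p.+1%:R.
  by apply: truncn_itv; rewrite divr_ge0 ?ltW.
have K0 := lazy_kernel_ge0 (R := R) adj.
have K1 := torus_kernel_sum (R := R) N_gt2 (isT : (0 < 2)%N).
have g := green_torus2 x; rewrite -aN in g.
have g0 : 0 < \sum_(t < N) heat K t x x by apply: lt_le_trans g; rewrite divr_gt0.
apply: (le_trans (hit_le_green (K := K) K0 K1 p.+1 T y g0)).
rewrite [leRHS]mulrDl lerD//.
  apply: (le_trans (hit_torus_far (d := 2) N_gt2 isT _ isT (divr_gt0 Np a0) yx)).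
  have l0 : 0 < 2 * (N%:R / a) ^+ 2 by rewrite mulr_gt0// exprn_gt0// divr_gt0.
  rewrite ler_pdivrMr// expr_div_n.
  have : p.+1%:R <= 2 * (N%:R ^+ 2 / a ^+ 3).
    have : 1 <= N%:R ^+ 2 / a ^+ 3 by rewrite ler_pdivlMr// mul1r.
    by rewrite -natr1; lra.
  rewrite (_ : 4 / a * _ = 2 ^+ 2 * (2 * (N%:R ^+ 2 / a ^+ 3))).
    by rewrite ler_pM2l.
  by field; rewrite gt_eqF.
(* During N^2 steps the term 16/(p + 1 + t) is bounded by its value at the cut, at most 16 a^3/N^2;
   later it is O(1/N^2), so the long horizon costs only O(T/N^2). *)
have term (t : nat) : heat K (p.+1 + t) y x <=
    18 * N%:R ^- 2 + 16 * a ^+ 3 * N%:R ^- 2 * (t < N ^ 2)%:R.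
  apply: (le_trans (heat_torus_le2 x y _)) => //.
  have n2 : 0 < N%:R ^- 2 :> R by rewrite invr_gt0.
  have tp : 0 < (p.+1 + t)%:R :> R by rewrite ltr0n.
  have [tN|tN] := ltnP t (N ^ 2)%N.
    rewrite mulr1 lerD//; first by rewrite ler_pM2r// ler_nat.
    rewrite -mulrA ler_pM2l// -[leLHS]mul1r ler_pdivrMr// mulrAC.
    rewrite ler_pdivlMr// mul1r natrD mulrDr.
    apply: (@le_trans _ _ (a ^+ 3 * p.+1%:R)); last by rewrite lerDl mulr_ge0// ltW.
    by rewrite -ler_pdivrMl// mulrC ltW.
  rewrite mulr0 addr0 (_ : 18 * _ = 2 * N%:R ^- 2 + 16 * N%:R ^- 2); last by ring.
  rewrite lerD2l ler_pM2l// lef_pV2 ?posrE// -natrX ler_nat.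
  by apply: (leq_trans tN); rewrite leq_addl.
rewrite ler_pdivrMr//; apply: (@le_trans _ _ ((18 * B + 34) * a ^+ 3)); last first.
  apply: (@le_trans _ _ (64 * (18 * B + 34) / a * (a ^+ 4 / 64))).
    rewrite (_ : _ / a * _ = (18 * B + 34) * a ^+ 3)//; by field; rewrite gt_eqF.
  by rewrite ler_pM2l// divr_gt0//; apply: mulr_gt0 => //; lra.
apply: (@le_trans _ _ (\sum_(t < T + N)
    (18 * N%:R ^- 2 + 16 * a ^+ 3 * N%:R ^- 2 * (t < N ^ 2)%:R))).
  by apply: ler_sum => t _; exact: term.
rewrite big_split/= -[X in _ + X]mulr_sumr sumr_const card_ord.
have cnt : \sum_(t < T + N) (t < N ^ 2)%:R <= N%:R ^+ 2 :> R.
  by rewrite -natr_sum -natrX ler_nat sum_ltn geq_minr.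
have b1 : 18 * N%:R ^- 2 *+ (T + N) <= (18 * B + 18) * a ^+ 3.
  rewrite -[leLHS]mulr_natr mulrAC ler_pdivrMr// natrD.
  have := aX 1 3 isT; rewrite expr1 => a13.
  have h1 : B * a * N%:R ^+ 2 <= B * a ^+ 3 * N%:R ^+ 2.
    by rewrite ler_pM2r// ler_wpM2l.
  have h2 : N%:R <= a ^+ 3 * N%:R ^+ 2 :> R.
    rewrite -[leLHS]mul1r ler_pM ?(le_trans a1 a13)//.
    by rewrite expr2 ler_peMl.
  lra.
have b2 : 16 * a ^+ 3 * N%:R ^- 2 * \sum_(t < T + N) (t < N ^ 2)%:R <= 16 * a ^+ 3.
  rewrite mulrAC ler_pdivrMr// ler_pM2l//; exact: mulr_gt0.
lra.
Qed.

End TorusHit2.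

(** * Expectations, limits and fourth roots *)

Section Expectation.
Context {disp : measure_display} {T : measurableType disp} {R : realType}.
Variable P : probability T R.

(* [ge0_le_integral] asks for measurable integrands; monotonicity of the
   integral of nonnegative functions does not need it. *)
Lemma le_expectation (f g : T -> R) : (forall w, 0 <= f w <= g w) ->
  ('E_P[f] <= 'E_P[g])%E.
Proof.
move=> fg; rewrite unlock !ge0_integralTE.
- apply: le_ereal_sup => _ [h hf <-]; exists h => // w; apply: (le_trans (hf w)).
  by rewrite lee_fin; case/andP: (fg w).
- by move=> w; rewrite lee_fin; case/andP: (fg w) => f0; apply: le_trans.
- by move=> w; rewrite lee_fin; case/andP: (fg w).
Qed.

Lemma expectation_le_cst (f : T -> R) (c : R) : (forall w, 0 <= f w <= c) ->
  (0 <= 'E_P[f] <= c%:E)%E.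
Proof.
move=> fc; rewrite expectation_ge0/= => [|w]; last by case/andP: (fc w).
by rewrite -[c%:E](expectation_cst P); apply: le_expectation.
Qed.

End Expectation.

Lemma cvg_cst_over {R : realType} (u : nat -> \bar R) (w : nat -> R) (C : R) :
  w @ \oo --> +oo -> (\forall N \near \oo, (0 <= u N <= (C / w N)%:E)%E) ->
  u N @[N --> \oo] --> 0%E.
Proof.
move=> wy uw.
apply: (@squeeze_cvge _ _ _ _ (fun=> 0%E) _ (fun N => (C / w N)%:E)) => //.
  exact: cvg_cst.
apply: cvg_EFin; first by near=> N.
have -> : 0 = C * 0 :> R by rewrite mulr0.
apply: cvgMr; apply/gtr0_cvgV0 => //.
by move/cvgryPgt: wy; exact.
Unshelve. all: by end_near.
Qed.

Section FourthRoot.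
Context {R : realType}.
Implicit Types f A : R.

Lemma fourth_root_exp f : 0 <= f -> (f `^ 4^-1) ^+ 4 = f.
Proof. by move=> f0; rewrite -powR_mulrn ?powR_ge0// -powRrM mulVf// powRr1. Qed.

Lemma fourth_root_sqr f : 0 <= f -> (f `^ 4^-1) ^+ 2 = f `^ 2^-1.
Proof.
by move=> f0; rewrite -powR_mulrn ?powR_ge0// -powRrM; congr (_ `^ _); field.
Qed.

Lemma fourth_root_ge f A : 0 <= f -> 0 <= A -> A ^+ 4 <= f -> A <= f `^ 4^-1.
Proof.
move=> f0 A0; rewrite -{1}(fourth_root_exp f0) ler_pXn2r// nnegrE ?powR_ge0//.
Qed.

Lemma cvg_fourth_root (u : nat -> R) : u @ \oo --> +oo -> (u N) `^ 4^-1 @[N --> \oo] --> +oo.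
Proof.
move=> uy; apply/cvgryPge => A; move/cvgryPge: uy => /(_ (`|A| ^+ 4)).
apply: filterS => N uA; apply: (le_trans (ler_norm A)); apply: fourth_root_ge => //.
by apply: le_trans uA; rewrite exprn_ge0.
Qed.

Lemma cvg_ln_nat : ln N%:R @[N --> \oo] --> (+oo : set_system R).
Proof.
apply/cvgryPge => A; near=> N.
rewrite -[A]expRK ler_ln ?posrE ?expR_gt0 ?ltr0n//; near: N.
- by have /cvgryPge := @cvgr_idn R; apply.
- by exists 1%N.
Unshelve. all: by end_near.
Qed.

End FourthRoot.

(** * The scales of the theorem *)

Section Scales.
Context {R : realType}.
Variable d : nat.

(* All errors in (iii) and (iv) are O(1 / scale): [ell] is [scale ^ 2] and [N] is [scale ^ 4]
   for [d >= 3], while [ell] is [N / scale] and [Lscale] is [scale] for [d = 2]. *)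
Definition scale (N : nat) : R := (if d == 2%N then ln N%:R else N%:R) `^ 4^-1.

Lemma cvg_scale : scale @ \oo --> +oo.
Proof.
rewrite /scale; case: eqP => _; apply: cvg_fourth_root; first exact: cvg_ln_nat.
exact: cvgr_idn.
Qed.

Lemma ln_nat_ge0 N : (0 < N)%N -> 0 <= ln (N%:R : R).
Proof. by move=> N0; rewrite ln_ge0// ler1n. Qed.

Lemma ell_scale_le N : (0 < N)%N -> 1 <= scale N -> 0 < (ell d N : R) /\
  ell d N * scale N <= N%:R /\ scale N <= N%:R.
Proof.
move=> N0; have Np : 0 < N%:R :> R by rewrite ltr0n.
rewrite /ell /scale; case: eqP => _.
  have := fourth_root_exp (ln_nat_ge0 N0); set w := _ `^ _ => w4 w1.
  have w0 : 0 < w := lt_le_trans ltr01 w1.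
  split; first by rewrite divr_gt0.
  rewrite divfK ?gt_eqF//; split => //.
  by apply: le_trans (ltW (ln_sublinear Np)); rewrite -w4 -[leLHS]expr1 ler_weXn2l.
have := fourth_root_exp (ltW Np); rewrite -(fourth_root_sqr (ltW Np)).
set w := _ `^ _ => w4 w1; have w0 : 0 < w := lt_le_trans ltr01 w1.
rewrite exprn_gt0// -exprSr -[leRHS]w4 ler_weXn2l//; split => //; split => //.
by rewrite -w4 -[leLHS]expr1 ler_weXn2l.
Qed.

Lemma hit_far : (2 <= d)%N -> exists C W0 : R, forall N, (2 < N)%N -> W0 <= scale N ->
  forall (x y : torus d N) T,
  T%:R <= Lscale d N * (256 * d ^ 3 * N ^ 2)%:R :> R ->
  y \notin gball (torus_adj d N) x (ell d N : R) ->
  hit (lazy_kernel (torus_adj d N)) x T y <= C / scale N.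
Proof.
move=> d2; rewrite /scale /ell /Lscale.
pose D : R := (256 * d ^ 3)%:R.
have D0 : 0 <= D by [].
have [dE|dE] := eqVneq d 2.
  exists (4 + 64 * (18 * D + 34)), 1 => N N2 w1 x y T.
  have N0 : (0 < N)%N := ltnW (ltnW N2).
  have := fourth_root_exp (ln_nat_ge0 N0); move: w1; set w := _ `^ _ => w1 w4 TN.
  move: x y; rewrite dE => x y yx.
  apply: (hit_far_2 N2 D0 w1 w4 _ yx).
  by rewrite -natrX mulrAC -natrM mulrC.
have d3 : (3 <= d)%N by rewrite ltn_neqAle eq_sym dE.
(* The factor 16 comes from (ln N)^2 = (4 ln w)^2 <= 16 w^2; the threshold ensures w >= 2 and w^2 >=
   16d + 1. *)
exists (129 * d%:R ^+ 2 + 4 * (D * 16) + 4), (16 * d%:R + 2) => N N2 wd x y T.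
have N0 : (0 < N)%N := ltnW (ltnW N2).
have Np : 0 < N%:R :> R by rewrite ltr0n.
have := fourth_root_exp (ltW Np); rewrite -(fourth_root_sqr (ltW Np)); move: wd.
set w := _ `^ _ => wd w4 TN yx.
have d0 : 0 <= d%:R :> R by [].
have w2 : 2 <= w by lra.
have w0 : 0 < w := lt_le_trans (ltr0n R 2) w2.
apply: (hit_far_ge3 N2 d3 _ w2 _ w4 _ yx).
- by rewrite mulr_ge0.
- rewrite expr2; apply: (@le_trans _ _ (1 * w)); first lra.
  by rewrite ler_pM2r//; lra.
apply: (le_trans TN); rewrite natrM -/D natrX -w4 lnXn//.
have l0 : 0 <= ln w by rewrite ln_ge0//; lra.
rewrite (_ : D * 16 * w ^+ 10 = (w *+ 4) ^+ 2 * (D * (w ^+ 4) ^+ 2)); last by ring.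
rewrite ler_wpM2r ?(mulr_ge0 D0 (sqr_ge0 _))// ler_pXn2r ?nnegrE ?mulrn_wge0 ?(ltW w0)//.
by rewrite lerMn2r/= ltW ?ln_sublinear.
Qed.

Lemma card_gball_le N (x : torus d N) : (0 < d)%N -> (2 < N)%N -> 5 <= scale N ->
  #|gball (torus_adj d N) x (2 * ell d N : R)|%:R / #|torus d N|%:R <= 5 / scale N.
Proof.
move=> d0 N2 w5; have N0 : (0 < N)%N := ltnW (ltnW N2).
have Np : 0 < N%:R :> R by rewrite ltr0n.
have w1 : 1 <= scale N by lra.
have w0 : 0 < scale N by lra.
have [l0 [lw wN]] := ell_scale_le N0 w1.
have l20 : 0 <= 2 * ell d N :> R by rewrite mulr_ge0// ltW.
set k := Num.truncn (2 * ell d N : R).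
have /andP[k1 k2] : k%:R <= 2 * (ell d N : R) < k.+1%:R by apply: truncn_itv.
have lN : 2 * ell d N < (N ^ d)%:R :> R.
  apply: (@lt_le_trans _ _ N%:R); last by rewrite ler_nat -[leqLHS]expn1 leq_pexp2l.
  by nra.
have := card_gball (ltnW N2) x lN k2; rewrite -(ler_nat R) natrX => cb.
rewrite card_torus ?(ltnW N2)// natrX.
apply: (@le_trans _ _ ((k.*2.+1%:R / N%:R) ^+ d)).
  by rewrite expr_div_n ler_pM2r ?invr_gt0 ?exprn_gt0.
have q5 : k.*2.+1%:R / N%:R <= 5 / scale N.
  rewrite ler_pdivrMr// mulrAC ler_pdivlMr// -natr1 -muln2 natrM.
  by nra.
apply: (le_trans _ q5); rewrite -[leRHS]expr1 ler_wiXn2l ?divr_ge0//.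
by apply: (le_trans q5); rewrite ler_pdivrMr// mul1r.
Qed.

End Scales.

(** Finite hitting times are integers, so the real bound [c] can be replaced by its integer part. *)
Lemma prob_hitting_time {R : realType} {V : finType} {disp : measure_display}
    {Om : measurableType disp} (e : rel V) (Q : V -> probability Om R)
    (Z : nat -> Om -> V) (x y : V) (c : R) : is_lazy_walk e Q Z -> 0 <= c ->
  Q y [set w | (hitting_time Z x w <= c%:E)%E] =
  (hit (lazy_kernel e) x (Num.truncn c) y)%:E.
Proof.
move=> ZQ c0; rewrite -(prob_hit ZQ); congr (Q y _).
apply/seteqP; split => w /=.
  (* A strict bound by the next integer extracts a visit time from the infimum without proving that
     it is attained. *)
  move=> hc; have : (hitting_time Z x w < ((Num.truncn c).+1%:R : R)%:E)%E.
    by apply: (le_lt_trans hc); rewrite lte_fin; case/andP: (truncn_itv c0).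
  move=> /ereal_inf_lt[_ [n /= Znx <-]]; rewrite lte_fin ltr_nat ltnS => nc.
  by exists n.
case=> n nc Znx; apply: (@le_trans _ _ (n%:R : R)%:E).
  by apply: ereal_inf_lbound; exists n.
by rewrite lee_fin -truncn_ge_nat.
Qed.

(** * Ball equivalence, ball volume and hitting before mixing *)

Section Torus.
Variables (R : realType) (d : nat).
Hypothesis d2 : (2 <= d)%N.
Variables (disp : nat -> measure_display) (T : forall N, measurableType (disp N)).
Variable P : forall N, probability (T N) R.

Lemma torus_balls_equiv (X Y : forall N, T N -> torus d N) :
  P N [set w | ~ rooted_equiv (torus_adj d N)
                     (X N w) (gball (torus_adj d N) (X N w) (ell d N : R))
                     (Y N w) (gball (torus_adj d N) (Y N w) (ell d N : R))]
       @[N --> \oo] --> 0%E.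
Proof.
apply: cvg_near_cst; exists 2%N => // N /= N2.
rewrite (_ : [set _ | _] = set0) ?measure0//; apply/seteqP; split => // w /=.
by apply; exact: torus_ball_equiv.
Qed.

Lemma torus_ball_volume (X : forall N, T N -> torus d N) :
  'E_(P N)[fun w => (
        #|gball (torus_adj d N) (X N w) (2 * ell d N : R)|%:R /
        #|torus d N|%:R)%R]%E
       @[N --> \oo] --> 0%E.
Proof.
apply: (cvg_cst_over (C := 5) (cvg_scale d)); near=> N.
apply: expectation_le_cst => w; rewrite divr_ge0//=.
apply: card_gball_le; first exact: ltnW.
- by near: N; exists 3%N.
- by near: N; have /cvgryPge := @cvg_scale R d; apply.
Unshelve. all: by end_near.
Qed.

Lemma torus_hitting_before_mixing
    (dispw : nat -> measure_display) (Om : forall N, measurableType (dispw N))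
    (Q : forall N, torus d N -> probability (Om N) R)
    (Z : forall N, nat -> Om N -> torus d N)
    (hZ : forall N, (1 < N)%N -> is_lazy_walk (torus_adj d N) (Q N) (Z N))
    (X : forall N, T N -> torus d N) :
  'E_(P N)[fun w => (
        sup [set fine (Q N y [set w' |
               (hitting_time (Z N) (X N w) w' <=
                (Lscale d N)%:E * mixing_time (torus_adj d N) (Q N) (Z N))%E])
            | y in [set y | y \notin
                       gball (torus_adj d N) (X N w) (ell d N : R)]])%R]%E
       @[N --> \oo] --> 0%E.
Proof.
have [C [W0 hC]] := @hit_far R d d2.
apply: (cvg_cst_over (C := `|C|) (cvg_scale d)); near=> N.
have N2 : (2 < N)%N by near: N; exists 3%N.
have wW : Num.max W0 1 <= scale d N :> R.
  by near: N; have /cvgryPge := @cvg_scale R d; apply.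
have {wW} [wW w1] : W0 <= scale d N :> R /\ 1 <= scale d N :> R.
  by move: wW; rewrite ge_max => /andP[].
have w0 : 0 < scale d N :> R := lt_le_trans ltr01 w1.
have ZN := hZ N (ltnW N2).
have mx0 : (0 <= mixing_time (torus_adj d N) (Q N) (Z N))%E.
  by apply: le_ereal_inf_tmp => _ [t _ <-]; rewrite lee_fin.
have mx1 := mixing_time_torus_le N2 (ltnW d2) ZN.
have mxfin : mixing_time (torus_adj d N) (Q N) (Z N) \is a fin_num.
  by rewrite ge0_fin_numE//; apply: le_lt_trans mx1 _; rewrite ltry.
have L0 : 0 <= Lscale d N :> R.
  rewrite /Lscale; case: ifP => _; first exact: powR_ge0.
  exact: sqr_ge0.
pose c : R := Lscale d N * fine (mixing_time (torus_adj d N) (Q N) (Z N)).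
have c0 : 0 <= c by rewrite mulr_ge0// fine_ge0.
have cE : ((Lscale d N)%:E * mixing_time (torus_adj d N) (Q N) (Z N))%E = c%:E.
  by rewrite EFinM fineK.
apply: expectation_le_cst => w; rewrite cE.
set S := (X in sup X).
have Sb : ubound S (`|C| / scale d N).
  move=> _ [y /= yx <-]; rewrite (prob_hitting_time _ _ ZN c0)/=.
  apply: (@le_trans _ _ (C / scale d N)).
    apply: (hC N N2 wW) => //; apply: (@le_trans _ _ c).
      by rewrite truncn_le.
    by rewrite ler_wpM2l// -lee_fin fineK.
  by rewrite ler_pM2r ?invr_gt0// ler_norm.
(* If the ball is the whole torus there is no [y], and [sup] of the empty set is 0. *)
have [->|S0] := eqVneq S set0.
  by rewrite sup0 lexx divr_ge0// ltW.
move/set0P : S0 => S0; apply/andP; split; last exact: ge_sup.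
case: (S0) => s Ss; apply: (@le_trans _ _ s).
  by case: Ss => y _ <-; rewrite fine_ge0.
by apply: sup_ubound => //; exists (`|C| / scale d N).
Unshelve. all: by end_near.
Qed.

End Torus.

(** * Dyadic analysis of the regularly varying tail *)

Section Tail.
Context {R : realType}.
Variables (alpha : R) (L : R -> R).
Hypothesis alpha_gt0 : 0 < alpha.
Hypothesis alpha_lt1 : alpha < 1.
Hypothesis L_sv : slowly_varying L.

Definition dyadic_tail (k : nat) : R := L (2 ^+ k) * (2 ^+ k) `^ (- alpha).

(* The ratio of consecutive tails tends to [2^-alpha], which lies strictly between 1/2 and 1. *)
Lemma dyadic_tail_ratio : exists rho sigma : R, exists k0 : nat,
  [/\ 1 < rho, 0 < sigma < 1 & forall k, (k0 <= k)%N ->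
    [/\ 0 < dyadic_tail k, rho * dyadic_tail k <= 2 * dyadic_tail k.+1
      & dyadic_tail k.+1 <= sigma * dyadic_tail k]].
Proof.
case: L_sv => _ Lpos Lrat; pose q : R := 2 `^ (- alpha).
have q0 : 0 < q by rewrite powR_gt0.
have powR2_gt1 (r : R) : 0 < r -> 1 < 2 `^ r :> R.
  move=> r0; have : (1 : R) `^ r < 2 `^ r by apply: gt0_ltr_powR; rewrite ?nnegrE// ltr1n.
  by rewrite powR1.
have q1 : q < 1 by rewrite /q powRN invf_lt1 ?powR_gt0// powR2_gt1.
have q2 : 1 < 2 * q.
  rewrite -{1}(@powRr1 R 2)// -powRD; last by rewrite pnatr_eq0 implybT.
  by rewrite powR2_gt1// subr_gt0.
(* With q the limit ratio, [rho] is the midpoint of 1 and 2q, and [sigma] that of q and 1. *)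
exists ((2 * q + 1) / 2), ((q + 1) / 2).
have lo : (2 * q + 1) / 2 < 2 * q by lra.
have hi : q < (q + 1) / 2 by lra.
have : \forall t \near +oo, [/\ 0 < L t, (2 * q + 1) / 2 / (2 * q) < L (2 * t) / L t
    & L (2 * t) / L t < (q + 1) / 2 / q].
  have r2 := Lrat 2 (ltr0n R 2).
  have n1 := cvgr_lt _ r2 ((q + 1) / 2 / q); rewrite ltr_pdivlMr// mul1r in n1.
  have n2 := cvgr_gt _ r2 ((2 * q + 1) / 2 / (2 * q)).
  rewrite ltr_pdivrMr ?mulr_gt0// mul1r in n2.
  by near=> t; split; near: t; [exact: Lpos|exact: n2|exact: n1].
case=> t0 [_ Ht]; exists (Num.truncn `|t0|).+1; split; [lra|by apply/andP; split; lra|].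
move=> k k0; pose t : R := 2 ^+ k.
have tp : 0 < t by rewrite exprn_gt0.
have [|Lt lo' hi'] := Ht t.
  apply: (le_lt_trans (ler_norm t0)); apply: (@lt_le_trans _ _ (Num.truncn `|t0|).+1%:R).
    by have /andP[] := truncn_itv (normr_ge0 t0).
  by rewrite /t -natrX ler_nat; apply: (leq_trans k0); apply: ltnW; apply: ltn_expl.
have gS : dyadic_tail k.+1 = L (2 * t) / L t * q * dyadic_tail k.
  rewrite /dyadic_tail exprS -/t powRM// ?(ltW tp)// -/q.
  by field; rewrite gt_eqF.
have g0 : 0 < dyadic_tail k by rewrite mulr_gt0// powR_gt0.
split=> //; rewrite gS.
- rewrite mulrA ler_pM2r// mulrCA -ler_pdivrMr ?mulr_gt0//; exact: ltW.
- by rewrite ler_pM2r// -ler_pdivlMr// ltW.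
Unshelve. all: by end_near.
Qed.

End Tail.

Section DyadicLevel.
Context {R : realType}.
Variables (g : nat -> R) (rho sigma : R) (k0 : nat).
Hypothesis rho_gt1 : 1 < rho.
Hypothesis sigma01 : 0 < sigma < 1.
Hypothesis gP : forall k, (k0 <= k)%N ->
  [/\ 0 < g k, rho * g k <= 2 * g k.+1 & g k.+1 <= sigma * g k].

(** From [k1] on, c g(k) decays geometrically and so falls below [K]; [k] is the index just before
    the first crossing. *)
Lemma dyadic_level (K c : R) k1 : 0 < K -> 0 <= c -> (k0 <= k1)%N -> K <= c * g k1 ->
  exists2 k, (k1 <= k)%N & K <= c * g k /\ c * g k.+1 < K.
Proof.
move=> K0 c0 k01 Kg.
have dec j : g (k1 + j)%N <= sigma ^+ j * g k1.
  elim: j => [|j IH]; first by rewrite addn0 mul1r.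
  have [_ _] := gP (leq_trans k01 (leq_addr j k1)); rewrite addnS => /le_trans; apply.
  rewrite exprS -mulrA ler_pM2l//; by case/andP: sigma01.
have [j0 Hj0] : exists j, c * g (k1 + j)%N < K.
  have : geometric (c * g k1) sigma @ \oo --> 0.
    by apply: cvg_geometric; case/andP: sigma01 => s0 s1; rewrite gtr0_norm.
  move=> /cvgr_lt/(_ K K0) [j _ /(_ j (leqnn j))] /= gj; exists j.
  apply: le_lt_trans gj; rewrite -mulrA ler_wpM2l// mulrC; exact: dec.
case: (ex_minnP (ex_intro (fun j => c * g (k1 + j)%N < K) j0 Hj0)) => -[|j] Hj jmin.
  by move: Hj; rewrite addn0 ltNge Kg.
exists (k1 + j)%N; first exact: leq_addr.
rewrite -addnS; split => //; rewrite leNgt; apply/negP => /jmin.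
by rewrite ltnn.
Qed.

Lemma dyadic_growth k m : (k0 <= k)%N -> rho ^+ m * (2 ^+ k * g k) <= 2 ^+ (k + m) * g (k + m)%N.
Proof.
move=> kk; elim: m => [|m IH]; first by rewrite addn0 mul1r.
have [_ gk _] := gP (leq_trans kk (leq_addr m k)).
rewrite addnS exprS exprS -mulrA; apply: (@le_trans _ _ (rho * (2 ^+ (k + m) * g (k + m)%N))).
  by rewrite ler_pM2l// (lt_trans ltr01).
rewrite [leRHS](_ : _ = 2 ^+ (k + m) * (2 * g (k + m).+1)); last by ring.
by rewrite mulrCA ler_wpM2l ?exprn_ge0.
Qed.

Lemma dyadic_tail_le k m : (k0 <= k)%N -> g k <= 2 ^+ m * g (k + m)%N.
Proof.
move=> kk; have [g0 _ _] := gP kk; have := dyadic_growth m kk.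
rewrite exprD -mulrA mulrCA ler_pM2l ?exprn_gt0//; apply: le_trans.
by rewrite ler_peMl ?(ltW g0)// exprn_ege1// ltW.
Qed.

(** The trade-off in [m]: going [m] levels down raises the expected count by at most a constant
    factor 2^(m+1), whereas the mass of the smaller weights, relative to 2^k, shrinks like
    rho^-m. *)
Lemma dyadic_level_bounds (K C c : R) k m : 0 <= C -> 0 <= c -> (k0 + m <= k)%N ->
  c * g k.+1 < K ->
  c * g (k - m)%N <= 2 ^+ m.+1 * K /\
  c / 2 ^+ k * (C * (2 ^+ (k - m) * g (k - m)%N)) <= 2 * C * K / rho ^+ m.
Proof.
move=> C0 c0 km gK; have k0m : (k0 <= k - m)%N by lia.
have kE : (k - m + m = k)%N by lia.
have rp n : 0 < rho ^+ n by rewrite exprn_gt0// (lt_trans ltr01).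
split.
  apply: (@le_trans _ _ (2 ^+ m.+1 * (c * g k.+1))); last by rewrite ler_pM2l ?exprn_gt0// ltW.
  by rewrite mulrCA ler_wpM2l//; have := dyadic_tail_le m.+1 k0m; rewrite addnS kE.
have gr := dyadic_growth m k0m; rewrite kE in gr.
have gk : g k <= 2 * g k.+1 by have := dyadic_tail_le 1 (leq_trans (leq_addr m k0) km); rewrite addn1.
rewrite ler_pdivlMr//.
apply: (@le_trans _ _ (C * (c * g k))).
  rewrite (_ : _ * rho ^+ m = C * (c / 2 ^+ k * (rho ^+ m * (2 ^+ (k - m) * g (k - m)%N)))); last by ring.
  rewrite ler_wpM2l// (_ : c * g k = c / 2 ^+ k * (2 ^+ k * g k)).
    by rewrite ler_wpM2l// divr_ge0// exprn_ge0.
  by field; rewrite expf_eq0 pnatr_eq0 andbF.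
rewrite (_ : 2 * C * K = C * (2 * K)); last by ring.
rewrite ler_wpM2l//; apply: (@le_trans _ _ (c * (2 * g k.+1))); first exact: ler_wpM2l.
by rewrite mulrCA ler_pM2l// ltW.
Qed.

End DyadicLevel.

(** * Truncated means *)

Section NonnegExpectation.
Context {disp : measure_display} {T : measurableType disp} {R : realType}.
Variable P : probability T R.

Lemma ge0_expectationD (f g : T -> R) :
  measurable_fun setT f -> measurable_fun setT g ->
  (forall w, 0 <= f w) -> (forall w, 0 <= g w) ->
  ('E_P[fun w => (f w + g w)%R] = 'E_P[f] + 'E_P[g])%E.
Proof.
move=> mf mg f0 g0; rewrite unlock -ge0_integralD//.
- by move=> w _; rewrite lee_fin.
- exact/measurable_EFinP.
- by move=> w _; rewrite lee_fin.
- exact/measurable_EFinP.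
Qed.

Lemma ge0_expectationZ (f : T -> R) (c : R) :
  measurable_fun setT f -> (forall w, 0 <= f w) -> 0 <= c ->
  ('E_P[fun w => (c * f w)%R] = c%:E * 'E_P[f])%E.
Proof.
move=> mf f0 c0; rewrite unlock -ge0_integralZl_EFin//.
- by move=> w _; rewrite lee_fin.
- exact/measurable_EFinP.
Qed.

Lemma ge0_expectation_sum (I : Type) (s : seq I) (f : I -> T -> R) :
  (forall i, measurable_fun setT (f i)) -> (forall i w, 0 <= f i w) ->
  ('E_P[fun w => (\sum_(i <- s) f i w)%R] = \sum_(i <- s) 'E_P[f i])%E.
Proof.
move=> mf f0; rewrite unlock -ge0_integral_sum//.
- by apply: eq_integral => w _; rewrite sumEFin.
- by move=> i; exact/measurable_EFinP.
- by move=> i w _; rewrite lee_fin.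
Qed.

Lemma indic_preimage_itv (X : T -> R) (i : interval R) w :
  \1_(X @^-1` [set` i]) w = (X w \in i)%:R :> R.
Proof. by rewrite indicE; congr (nat_of_bool _)%:R; apply/idP/idP; rewrite inE. Qed.

Lemma measurable_truncation (X : {RV P >-> R}) (b : R) :
  measurable_fun setT (fun w => X w * \1_(X @^-1` `]-oo, b]) w).
Proof.
apply: measurable_funM => //; apply: measurable_indic.
by rewrite -[X in measurable X]setTI; exact: measurable_funPT.
Qed.

Section TruncatedMean.
Variables (X : {RV P >-> R}) (g : nat -> R) (rho : R) (k0 : nat).
Hypothesis X_gt0 : forall w, 0 < X w.
Hypothesis Xg : forall k, P (X @^-1` `]2 ^+ k, +oo[) = (g k)%:E.
Hypothesis rho_gt1 : 1 < rho.
Hypothesis gP : forall k, (k0 <= k)%N -> 0 < g k /\ rho * g k <= 2 * g k.+1.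

Definition truncated (b : R) (w : T) : R := X w * \1_(X @^-1` `]-oo, b]) w.

Lemma truncated_ge0 b w : 0 <= truncated b w.
Proof. by rewrite /truncated mulr_ge0// ltW. Qed.

(** A dyadic Karamata bound. The first entry of the maximum settles [k0]. One more level adds at
    most 2^(j+1) g(j), and (C + 2) 2^j g(j) <= C rho 2^j g(j) <= C 2^(j+1) g(j+1) as soon as C >=
    2/(rho - 1). *)
Lemma truncated_mean_le k : (k0 <= k)%N ->
  ('E_P[truncated (2 ^+ k)] <=
    (Num.max (2 ^+ k0 / (2 ^+ k0 * g k0)) (2 / (rho - 1)) * (2 ^+ k * g k))%:E)%E.
Proof.
set C := Num.max _ _.
have C1 : 2 ^+ k0 / (2 ^+ k0 * g k0) <= C by rewrite /C le_max lexx.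
have C2 : 2 / (rho - 1) <= C by rewrite /C le_max lexx orbT.
move=> kk; rewrite -(subnKC kk); elim: (k - k0)%N => [|m IH].
  have [g0 _] := gP (leqnn k0); rewrite addn0.
  apply: le_trans (_ : ((2 ^+ k0 : R)%:E <= _)%E); last first.
    by rewrite lee_fin -ler_pdivrMr// mulr_gt0// exprn_gt0.
  suff /(expectation_le_cst P)/andP[] : forall w, 0 <= truncated (2 ^+ k0) w <= 2 ^+ k0 by [].
  move=> w; rewrite truncated_ge0/= /truncated indic_preimage_itv in_itv/=.
  by have [Xw|Xw] /= := leP (X w) (2 ^+ k0); rewrite ?mulr1 ?mulr0 ?exprn_ge0.
rewrite addnS; move: (leq_addr m k0) IH; move: (k0 + m)%N => j kj IH.
have [g0 gk] := gP kj.
apply: (@le_trans _ _ ('E_P[fun w => (truncated (2 ^+ j) w +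
    2 ^+ j.+1 * \1_(X @^-1` `]2 ^+ j, +oo[) w)%R])%E).
  apply: le_expectation => w; rewrite truncated_ge0/=.
  rewrite /truncated !indic_preimage_itv !in_itv/= andbT.
  have Xw := ltW (X_gt0 w).
  have [Xk|Xk] := leP (X w) (2 ^+ j); rewrite !(mulr1, mulr0, add0r, addr0).
    by rewrite ler_piMr// lern1 leq_b1.
  by have [Xk1|Xk1] /= := leP (X w) (2 ^+ j.+1); rewrite ?mulr1 ?mulr0 ?exprn_ge0.
have mA : measurable (X @^-1` `]2 ^+ j, +oo[).
  by rewrite -[X in measurable X]setTI; exact: measurable_funPT.
rewrite ge0_expectationD; last 4 first.
- exact: measurable_truncation.
- by apply: measurable_funM; [exact: measurable_cst|exact: measurable_indic].
- exact: truncated_ge0.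
- by move=> w; rewrite mulr_ge0 ?exprn_ge0// indicE.
rewrite ge0_expectationZ ?exprn_ge0//.
rewrite expectation_indic// Xg; apply: (le_trans (leeD IH (lexx _))).
rewrite -EFinM -EFinD lee_fin.
have C0 : 0 <= C by apply: le_trans C2; rewrite divr_ge0// subr_ge0 ltW.
have : 0 < 2 ^+ j * g j by rewrite mulr_gt0// exprn_gt0.
have : C * (2 ^+ j * (rho * g j)) <= C * (2 ^+ j * (2 * g j.+1)).
  by rewrite ler_wpM2l// ler_wpM2l// exprn_ge0.
move: C2; rewrite ler_pdivrMr ?subr_gt0// => C2 le1 p0.
have := ler_wpM2r (ltW p0) C2; rewrite !exprS; lra.
Qed.

End TruncatedMean.
End NonnegExpectation.

(** * Deterministic bound for a decreasing list *)

Section SortedTail.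
Context {R : realType}.

(** If entry [j] exceeded [b], so would the [j + 1] first entries, more than the count allows. *)
Lemma sorted_nth_le_of_count (s : seq R) (b : R) (J j : nat) :
  sorted (fun x y => y <= x) s -> (count (fun x => (b < x)%R) s <= J)%N ->
  (J <= j)%N -> (j < size s)%N -> nth 0 s j <= b.
Proof.
move=> ss cJ Jj js; rewrite leNgt; apply/negP => bj.
have : (j.+1 <= count (fun x => (b < x)%R) s)%N.
  rewrite -(cat_take_drop j.+1 s) count_cat; apply: leq_trans (leq_addr _ _).
  have /eqP -> : count (fun x => (b < x)%R) (take j.+1 s) == size (take j.+1 s).
    rewrite -all_count; apply/(all_nthP 0) => i; rewrite size_take_min => ij.
    rewrite nth_take; last by lia.
    apply: (lt_le_trans bj).
    have tr : transitive (fun x y : R => y <= x) by move=> y x z xy yz; exact: le_trans yz xy.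
    have := sorted_leq_nth tr (fun x => lexx x) 0 ss; apply; rewrite ?inE//; lia.
  by rewrite size_take_min; lia.
by lia.
Qed.

(* Either all entries are at most [B], or more than [J] of them exceed [b], or the entries from
   rank [J] on are at most [b] while the total exceeds [B]. *)
Lemma sorted_tail_ratio_le (s : seq R) (b B : R) (J : nat) :
  sorted (fun x y => y <= x) s -> (forall x, x \in s -> 0 < x) -> (0 < J)%N -> 0 < B ->
  (\sum_(0 <= j < size s | (J <= j)%N) nth 0 s j) / (\sum_(x <- s) x) <=
  J%:R^-1 * (\sum_(x <- s) (b < x)%R%:R) + (all (fun x => x <= B) s)%:R
  + B^-1 * \sum_(x <- s) x * (x <= b)%R%:R.
Proof.
move=> ss s0 J0 B0.
have Jp : 0 < J%:R :> R by rewrite ltr0n.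
have sum0 (f : R -> bool) : 0 <= \sum_(x <- s) x * (f x)%:R.
  by rewrite big_seq; apply: sumr_ge0 => x /s0 xs; rewrite mulr_ge0// ltW.
have S0 : 0 <= \sum_(x <- s) x by rewrite big_seq; apply: sumr_ge0 => x /s0 /ltW.
have A1 : 0 <= J%:R^-1 * (\sum_(x <- s) (b < x)%R%:R) :> R.
  by rewrite mulr_ge0 ?invr_ge0// sumr_ge0.
have A3 : 0 <= B^-1 * \sum_(x <- s) x * (x <= b)%R%:R.
  by rewrite mulr_ge0 ?invr_ge0 ?sum0// ltW.
have nth0 j : 0 <= nth 0 s j.
  have [js|js] := ltnP j (size s); last by rewrite nth_default.
  by rewrite ltW// s0// mem_nth.
have tail_le : \sum_(0 <= j < size s | (J <= j)%N) nth 0 s j <= \sum_(x <- s) x.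
  rewrite [leRHS](big_nth 0) [leLHS]big_mkcond/=; apply: ler_sum => j _; by case: ifP.
have ratio1 : (\sum_(0 <= j < size s | (J <= j)%N) nth 0 s j) / (\sum_(x <- s) x) <= 1.
  have [->|Sn] := eqVneq (\sum_(x <- s) x) 0; first by rewrite invr0 mulr0.
  by rewrite ler_pdivrMr ?mul1r// lt_neqAle eq_sym Sn.
have [sB|sB] := boolP (all _ s); first by apply: (le_trans ratio1); rewrite /=; lra.
rewrite addr0.
have [cJ|cJ] := leqP (count (fun x => (b < x)%R) s) J; last first.
  apply: (le_trans ratio1); rewrite -[leLHS]addr0 lerD// ler_pdivlMl// mulr1.
  rewrite -natr_sum ler_nat; apply: ltnW; move: cJ; rewrite -sum1_count big_mkcond.
  by congr (_ < _)%N; apply: eq_bigr => x _; case: ifP.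
have SB : B <= \sum_(x <- s) x.
  move/allPn: sB => [x xs]; rewrite -ltNge => xB; apply: (le_trans (ltW xB)).
  rewrite (big_rem x)//= lerDl big_seq; apply: sumr_ge0 => y /mem_rem /s0; exact: ltW.
rewrite -[leLHS]add0r lerD// mulrC.
apply: ler_pM; rewrite ?invr_ge0//.
- by apply: sumr_ge0.
- by rewrite lef_pV2// posrE// (lt_le_trans B0).
rewrite [leRHS](big_nth 0) [leLHS]big_mkcond/= big_nat_cond [leRHS]big_nat_cond.
apply: ler_sum => j; rewrite andbT => /andP[_ js].
case: ifP => Jj; last by rewrite mulr_ge0.
by rewrite (sorted_nth_le_of_count ss cJ Jj js) mulr1.
Qed.

End SortedTail.

(** * Sums over vertices and sums over ranks *)

Section Enumeration.
Context {R : realType} {V : finType}.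

Lemma mem_enumeration (x : #|V|.-tuple V) : uniq x -> forall v, v \in x.
Proof.
move=> /card_uniqP cx v; rewrite size_tuple in cx.
by have [_] := subset_leqif_card (subset_predT (mem x)); rewrite cx eqxx => /esym/fintype.subsetP ->.
Qed.

Lemma sum_index (s : seq V) (F : nat -> R) : uniq s ->
  \sum_(v <- s) F (index v s) = \sum_(0 <= j < size s) F j.
Proof.
case: s => [|v0 s] us; first by rewrite big_nil big_geq.
rewrite (big_nth v0); apply: eq_big_nat => j /andP[_ js].
by rewrite index_uniq.
Qed.

Lemma sum_enumeration (x : #|V|.-tuple V) (F : nat -> R) : uniq x ->
  \sum_v F (index v x) = \sum_(0 <= j < #|V|) F j.
Proof.
move=> ux; have mx := mem_enumeration ux.
rewrite (perm_big (tval x))/=; last first.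
  by apply: uniq_perm; rewrite ?index_enum_uniq// => v; rewrite mem_index_enum mx.
rewrite -[X in index_iota _ X](size_tuple x); exact: sum_index.
Qed.

Lemma sum_notin_take (x : #|V|.-tuple V) (F : nat -> R) (J : nat) : uniq x ->
  \sum_(v | v \notin take (minn J #|V|) x) F (index v x) =
  \sum_(0 <= j < #|V| | (J <= j)%N) F j.
Proof.
move=> ux; have mx := mem_enumeration ux.
rewrite [RHS]big_mkcond/= -(sum_enumeration (fun j => if (J <= j)%N then F j else 0) ux).
rewrite [LHS]big_mkcond/=; apply: eq_bigr => v _.
rewrite in_take// -leqNgt; have : (index v x < #|V|)%N by have := mx v; rewrite -index_mem size_tuple.
by move=> iV; rewrite geq_min [X in _ || X]leqNgt iV orbF.
Qed.

End Enumeration.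

(** * Mass outside the heaviest vertices *)

Section WeightTail.
Context {disp : measure_display} {T : measurableType disp} {R : realType}.
Variable P : probability T R.
Context {V : finType}.
Variables (e : rel V) (D : nat).
Hypothesis deg_e : forall v, deg e v = D.
Hypothesis D_gt0 : (0 < D)%N.
Variable mu : probability (measurableTypeR R) R.
Variable W : nat -> {RV P >-> R}.
Hypothesis W_iid : iid_with_law mu W.
Hypothesis W_gt0 : forall j w, 0 < W j w.
Variable xs : T -> #|V|.-tuple V.
Hypothesis xs_enum : random_enumeration W xs.

Local Notation n := #|V|.

Lemma size_ordered_weights w : size (ordered_weights V W w) = n.
Proof. by rewrite size_sort size_map size_iota. Qed.

Lemma mem_ordered_weights w x : x \in ordered_weights V W w -> 0 < x.
Proof. by rewrite mem_sort => /mapP[j _ ->]. Qed.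

Lemma sorted_ordered_weights w : sorted (fun a b => b <= a) (ordered_weights V W w).
Proof. by apply: sort_sorted => a b; exact: le_total. Qed.

Lemma sum_ordered_weights w (f : R -> R) :
  \sum_(x <- ordered_weights V W w) f x = \sum_(j <- iota 0 n) f (W j w).
Proof. by rewrite (perm_big [seq W j w | j <- iota 0 n]) ?perm_sort// big_map. Qed.

Lemma vertex_weight_ge0 w v : 0 <= vertex_weight W xs w v.
Proof.
rewrite /vertex_weight; have [vn|vn] := ltnP (index v (xs w)) (size (ordered_weights V W w)).
  by rewrite ltW// (@mem_ordered_weights w)// mem_nth.
by rewrite nth_default.
Qed.

Lemma nuE w v : nu e W xs w v = vertex_weight W xs w v / \sum_y vertex_weight W xs w y.
Proof.
rewrite /nu deg_e; under eq_bigr do rewrite deg_e.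
by rewrite -mulr_sumr -mulf_div mulfV ?mul1r// pnatr_eq0 -lt0n.
Qed.

Lemma sum_nu_bounds w (A : pred V) : 0 <= \sum_(v | A v) nu e W xs w v <= 1.
Proof.
have S0 : 0 <= \sum_y vertex_weight W xs w y.
  by apply: sumr_ge0 => v _; exact: vertex_weight_ge0.
under eq_bigr do rewrite nuE.
have A0 : 0 <= \sum_(v | A v) vertex_weight W xs w v.
  by apply: sumr_ge0 => v _; exact: vertex_weight_ge0.
rewrite -mulr_suml divr_ge0//=.
have [->|Sn] := eqVneq (\sum_y vertex_weight W xs w y) 0; first by rewrite invr0 mulr0.
rewrite ler_pdivrMr; last by rewrite lt_neqAle eq_sym Sn.
rewrite mul1r big_mkcond; apply: ler_sum => v _; case: ifP => // _.
exact: vertex_weight_ge0.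
Qed.

Lemma sum_nu_le w (b B : R) (J : nat) : uniq (xs w) -> (0 < J)%N -> 0 < B ->
  \sum_(v | v \notin take (minn J n) (xs w)) nu e W xs w v <=
  J%:R^-1 * (\sum_(i <- iota 0 n) \1_(W i @^-1` `]b, +oo[) w)
  + \1_(\bigcap_(i in [set` iota 0 n]) (W i @^-1` `]-oo, B])) w
  + B^-1 * \sum_(i <- iota 0 n) truncated (W i) b w.
Proof.
move=> ux J0 B0; under eq_bigr do rewrite nuE.
rewrite -mulr_suml /vertex_weight.
rewrite (sum_notin_take (fun j => nth 0 (ordered_weights V W w) j) J ux).
rewrite (sum_enumeration (fun j => nth 0 (ordered_weights V W w) j) ux).
rewrite -(size_ordered_weights w) -(big_nth 0 xpredT (fun x => x)).
apply: (le_trans (sorted_tail_ratio_le b (sorted_ordered_weights w) _ J0 B0)).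
  by move=> x; exact: mem_ordered_weights.
rewrite size_ordered_weights !sum_ordered_weights lerD//; last first.
  rewrite ler_wpM2l ?invr_ge0 ?(ltW B0)//; apply: ler_sum => i _.
  by rewrite /truncated indic_preimage_itv in_itv.
rewrite lerD//.
  rewrite ler_wpM2l ?invr_ge0//; apply: ler_sum => i _.
  by rewrite indic_preimage_itv in_itv/= andbT.
case: allP => [Wall|//]; rewrite indicE mem_set// => i iV /=.
by rewrite in_itv/=; apply: Wall; rewrite mem_sort; apply/mapP; exists i.
Qed.

Lemma measurable_weight_preimage i (I : interval R) : measurable (W i @^-1` [set` I]).
Proof. by rewrite -[X in measurable X]setTI; exact: measurable_funPT. Qed.

(** (1 - p)^k <= exp(-kp) <= 1/(kp). *)
Lemma one_sub_exp_le (p : R) k : (0 < k)%N -> 0 < p <= 1 -> (1 - p) ^+ k <= (k%:R * p)^-1.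
Proof.
move=> k0 /andP[p0 p1]; have kp : 0 < k%:R * p by rewrite mulr_gt0// ltr0n.
apply: (@le_trans _ _ (expR (- p) ^+ k)).
  by rewrite lerXn2r ?nnegrE ?expR_ge0 ?subr_ge0// -[1 - p]/(1 + - p) expR_ge1Dx.
rewrite -expRM_natl mulrN expRN lef_pV2 ?posrE ?expR_gt0//.
by apply: le_trans (expR_ge1Dx _); rewrite lerDr.
Qed.

Lemma prob_max_weight_le (B gB : R) : (0 < n)%N -> mu [set` `]B, +oo[] = gB%:E -> 0 < gB ->
  (P (\bigcap_(i in [set` iota 0 n]) (W i @^-1` `]-oo, B])) <= ((n%:R * gB)^-1)%:E)%E.
Proof.
move=> n0 muB gB0.
have gB1 : gB <= 1 by rewrite -lee_fin -muB probability_le1.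
rewrite W_iid.2 ?iota_uniq//.
rewrite (eq_bigr (fun=> (1 - gB)%:E)) => [|i _]; last first.
  by rewrite W_iid.1// -setCitvr probability_setC// muB EFinB.
rewrite prodEFin lee_fin big_const_seq count_predT size_iota iter_mulr_1.
by apply: one_sub_exp_le; rewrite // gB0.
Qed.

Lemma measurable_fin_preimage (F : finType) (f : T -> F) (S : set F) :
  (forall a, measurable (f @^-1` [set a])) -> measurable (f @^-1` S).
Proof.
move=> mf; rewrite (_ : _ @^-1` _ = \bigcup_(a in S) f @^-1` [set a]).
  by apply: fin_bigcup_measurable => // a _.
by apply/seteqP; split => w /=; [move=> Sw; exists (f w)|case=> a Sa ->].
Qed.

Lemma measurable_not_uniq : measurable [set w | ~~ uniq (xs w)].
Proof.
by apply: (@measurable_fin_preimage _ xs [set t | ~~ uniq t]) => t; case: (xs_enum.1 t).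
Qed.

Lemma prob_not_uniq : P [set w | ~~ uniq (xs w)] = 0%E.
Proof.
rewrite (@measure_fin_partition _ _ _ _ _ xs) => [|t|]; last 2 first.
- by case: (xs_enum.1 t).
- exact: measurable_not_uniq.
apply: big1 => t _; have [ut|ut] := boolP (uniq t).
  rewrite (_ : _ `&` _ = set0) ?measure0//; apply/seteqP; split => // w [/= + wt].
  by rewrite wt ut.
apply/eqP; rewrite eq_le measure_ge0 andbT.
have [mt Pt] := xs_enum.1 t; rewrite inE (negbTE ut) mul0r in Pt.
apply: (@le_trans _ _ (P (xs @^-1` [set t]))); last by rewrite Pt.
apply: le_measure; [|by rewrite inE|by move=> w []].
by rewrite inE; apply: measurableI => //; exact: measurable_not_uniq.
Qed.

(** The three errors are Markov's bound for having more than [J] weights above [b], the chance that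
    no weight exceeds [B], and the mean total of the weights up to [b] compared with [B]. *)
Lemma expectation_nu_le (b gb B gB M : R) (J : nat) : (0 < n)%N -> (0 < J)%N -> 0 < B ->
  mu [set` `]b, +oo[] = gb%:E -> mu [set` `]B, +oo[] = gB%:E -> 0 < gB ->
  (forall i, ('E_P[truncated (W i) b] <= M%:E)%E) ->
  ('E_P[fun w => (\sum_(v | v \notin take (minn J n) (xs w)) nu e W xs w v)%R]
    <= (J%:R^-1 * (n%:R * gb) + (n%:R * gB)^-1 + B^-1 * (n%:R * M))%:E)%E.
Proof.
move=> n0 J0 B0 mub muB gB0 EM.
pose h1 w := \sum_(i <- iota 0 n) \1_(W i @^-1` `]b, +oo[) w : R.
pose h2 w := \1_(\bigcap_(i in [set` iota 0 n]) (W i @^-1` `]-oo, B])) w : R.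
pose h3 w := \sum_(i <- iota 0 n) truncated (W i) b w.
(* [h4] covers the null event that [xs] has repetitions, where only the bound 1 on the mass is
   used. *)
pose h4 w := \1_[set w | ~~ uniq (xs w)] w : R.
have ti0 i w : 0 <= truncated (W i) b w by apply: truncated_ge0.
have h10 w : 0 <= h1 w by apply: sumr_ge0 => i _; rewrite indicE.
have h20 w : 0 <= h2 w by rewrite /h2 indicE.
have h30 w : 0 <= h3 w by apply: sumr_ge0 => i _; exact: ti0.
have h40 w : 0 <= h4 w by rewrite /h4 indicE.
have mcap : measurable (\bigcap_(i in [set` iota 0 n]) (W i @^-1` `]-oo, B])).
  by apply: bigcap_measurable => [|i _]; [exists 0%N; rewrite /= mem_iota|exact: measurable_weight_preimage].
have mind i : measurable_fun setT (\1_(W i @^-1` `]b, +oo[) : T -> R).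
  by apply: measurable_indic; exact: measurable_weight_preimage.
have m1 : measurable_fun setT h1 by apply: measurable_sum.
have m2 : measurable_fun setT h2 by exact: measurable_indic.
have m3 : measurable_fun setT h3 by apply: measurable_sum => i; exact: measurable_truncation.
have m4 : measurable_fun setT h4 by apply: measurable_indic; exact: measurable_not_uniq.
have Ji : 0 <= J%:R^-1 :> R by rewrite invr_ge0.
have Bi : 0 <= B^-1 by rewrite invr_ge0 ltW.
have mJ1 : measurable_fun setT (fun w => J%:R^-1 * h1 w).
  by apply: measurable_funM => //; exact: measurable_cst.
have mB3 : measurable_fun setT (fun w => B^-1 * h3 w).
  by apply: measurable_funM => //; exact: measurable_cst.
apply: (@le_trans _ _ ('E_P[fun w => (J%:R^-1 * h1 w + (h2 w + (B^-1 * h3 w + h4 w)))%R])%E).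
  apply: le_expectation => w; have /andP[-> nu1] := sum_nu_bounds w
    (fun v => v \notin take (minn J n) (xs w)).
  have [ux|ux] := boolP (uniq (xs w)).
    apply: (le_trans (sum_nu_le b ux J0 B0)).
    by rewrite -/(h1 w) -/(h2 w) -/(h3 w) !addrA lerDl.
  apply: (le_trans nu1); have -> : h4 w = 1 by rewrite /h4 indicE mem_set.
  by rewrite !addrA lerDr !addr_ge0// mulr_ge0.
rewrite ge0_expectationD//; last 3 first.
- by apply: measurable_funD => //; apply: measurable_funD.
- by move=> w; rewrite mulr_ge0.
- by move=> w; rewrite !addr_ge0// mulr_ge0.
rewrite ge0_expectationD//; last 2 first.
- by apply: measurable_funD.
- by move=> w; rewrite !addr_ge0// mulr_ge0.
rewrite ge0_expectationD//; last by move=> w; rewrite mulr_ge0.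
rewrite !ge0_expectationZ//.
have -> : ('E_P[h4] = 0)%E by rewrite expectation_indic ?prob_not_uniq//; exact: measurable_not_uniq.
have -> : ('E_P[h1] = (n%:R * gb)%:E)%E.
  rewrite ge0_expectation_sum//.
  rewrite (eq_bigr (fun=> gb%:E)) => [|i _]; last first.
    rewrite expectation_indic; last exact: measurable_weight_preimage.
    by rewrite W_iid.1.
  by rewrite sumEFin big_const_seq count_predT size_iota iter_addr addr0 mulr_natl.
have E3 : ('E_P[h3] <= (n%:R * M)%:E)%E.
  rewrite ge0_expectation_sum//; last by move=> i; exact: measurable_truncation.
  apply: (@le_trans _ _ (\sum_(i <- iota 0 n) M%:E)%E); first by apply: lee_sum => i _.
  by rewrite sumEFin big_const_seq count_predT size_iota iter_addr addr0 mulr_natl.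
have E2 : ('E_P[h2] <= ((n%:R * gB)^-1)%:E)%E.
  by rewrite expectation_indic//; exact: prob_max_weight_le.
rewrite adde0 -addrA !EFinD !EFinM; apply: leeD => //; apply: leeD => //.
by apply: lee_wpmul2l; rewrite ?lee_fin// -EFinM.
Qed.

End WeightTail.

Lemma cvg0_of_le {R : realType} (u : nat -> \bar R) :
  (forall eps : R, 0 < eps -> \forall N \near \oo, (0 <= u N <= eps%:E)%E) ->
  u N @[N --> \oo] --> 0%E.
Proof.
move=> ueps; apply/fine_cvgP; split.
  near=> N; have /andP[u0 u1] : (0 <= u N <= 1%:E)%E.
    by near: N; exact: ueps.
  by rewrite ge0_fin_numE// (le_lt_trans u1)// ltry.
apply/cvgr0Pnorm_le => eps eps0; near=> N.
have /andP[u0 u1] : (0 <= u N <= eps%:E)%E by near: N; exact: ueps.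
have ufin : u N \is a fin_num by rewrite ge0_fin_numE// (le_lt_trans u1)// ltry.
by rewrite /= ger0_norm ?fine_ge0// -lee_fin fineK.
Unshelve. all: by end_near.
Qed.

(** Order of choices: [K] and [m] depend on [eps] alone, then [N] is taken large, and the level [k]
    depends on [N]. Hence the bound 2^(m+1) K on the count stays fixed while [J N] grows. *)
Lemma torus_weight_tail (R : realType) (d : nat) (hd : (2 <= d)%N)
  (alpha : R) (halpha0 : 0 < alpha) (halpha1 : alpha < 1)
  (L : R -> R) (hL : slowly_varying L)
  (mu : probability (measurableTypeR R) R)
  (hmu : forall t : R, 0 < t -> mu [set` `]t, +oo[] = (L t * t `^ (- alpha))%:E)
  (disp : nat -> measure_display) (T : forall N, measurableType (disp N))
  (P : forall N, probability (T N) R)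
  (W : forall N, nat -> {RV (P N) >-> R})
  (hW : forall N, (1 < N)%N -> iid_with_law mu (W N))
  (hWpos : forall N, (1 < N)%N -> forall j w, 0 < W N j w)
  (xs : forall N, T N -> #|torus d N|.-tuple (torus d N))
  (hxs : forall N, (1 < N)%N -> random_enumeration (W N) (xs N))
  (J : nat -> nat) : J @ \oo --> \oo ->
  'E_(P N)[fun w => (
        \sum_(v | v \notin take (minn (J N) #|torus d N|) (xs N w))
           nu (torus_adj d N) (W N) (xs N) w v)%R]%E
       @[N --> \oo] --> 0%E.
Proof.
move=> Joo; apply: cvg0_of_le => eps eps0.
pose g := dyadic_tail alpha L.
have mug k : mu [set` `]2 ^+ k, +oo[] = (g k)%:E by rewrite hmu// exprn_gt0.
have [rho [sigma [k0 [rho1 sigma01 gP]]]] := dyadic_tail_ratio halpha0 halpha1 hL.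
have gP' k : (k0 <= k)%N -> 0 < g k /\ rho * g k <= 2 * g k.+1 by move=> /gP[].
pose C := Num.max (2 ^+ k0 / (2 ^+ k0 * g k0)) (2 / (rho - 1)).
have C0 : 0 <= C by rewrite le_max [X in _ || X]divr_ge0 ?orbT// subr_ge0 ltW.
(* So that the error 1/K is eps/4. *)
pose K := 4 / eps; have K0 : 0 < K by rewrite divr_gt0.
have [m Hm] : exists m, 2 * C * K / rho ^+ m <= eps / 4.
  have : geometric (2 * C * K) rho^-1 @ \oo --> 0.
    apply: cvg_geometric; rewrite gtr0_norm ?invr_gt0 ?(lt_trans ltr01)//.
    by rewrite invf_lt1// (lt_trans ltr01).
  have e4 : 0 < eps / 4 by rewrite divr_gt0.
  move=> /cvgr_lt/(_ _ e4)[m _ /(_ m (leqnn m))] /= Hm; exists m.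
  by rewrite -exprVn ltW.
have gkm : 0 < g (k0 + m)%N by case: (gP' _ (leq_addr m k0)).
near=> N.
have N2 : (2 < N)%N by near: N; exists 3%N.
have N1 : (1 < N)%N := ltnW N2.
have JN : 2 ^+ m.+1 * K * 4 / eps <= (J N)%:R.
  by near: N; move/(@cvgrnyP R)/cvgryPge : Joo; exact.
(* This forces the level [k] to be at least [k0 + m], so that the ratio bounds still hold at
   [k - m]. *)
have NK : K / g (k0 + m)%N <= N%:R.
  by near: N; have /cvgryPge := @cvgr_idn R; apply.
set n := #|torus d N|.
have nE : n = (N ^ d)%N by rewrite /n card_torus.
have n_gt0 : (0 < n)%N by rewrite nE expn_gt0 (ltnW N1).
have nK : K <= n%:R * g (k0 + m)%N.
  rewrite -ler_pdivrMr//; apply: (le_trans NK); rewrite ler_nat nE.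
  by rewrite -[leqLHS]expn1 leq_pexp2l ?(ltnW N1)// ltnW.
have [k k1 [Kk kK]] := dyadic_level sigma01 gP K0 (ler0n R n) (leq_addr m k0) nK.
have [b1 b2] := dyadic_level_bounds rho1 sigma01 gP C0 (ler0n R n) k1 kK.
have J0 : (0 < J N)%N.
  rewrite -(ltr_nat R); apply: lt_le_trans JN.
  by rewrite divr_gt0// mulr_gt0// mulr_gt0// exprn_gt0.
have km : (k0 <= k - m)%N by rewrite leq_subRL ?(leq_trans (leq_addl k0 m) k1)// addnC.
have k0k : (k0 <= k)%N := leq_trans (leq_addr m k0) k1.
have EM i : ('E_(P N)[truncated (W N i) (2 ^+ (k - m))] <=
    (C * (2 ^+ (k - m) * g (k - m)%N))%:E)%E.
  apply: truncated_mean_le => //; first exact: hWpos.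
  move=> j; rewrite -(mug j); exact: (hW N N1).1.
have [gk _] := gP' _ k0k.
have Bk : 0 < 2 ^+ k :> R by rewrite exprn_gt0.
have D0 : (0 < d.*2)%N by rewrite double_gt0 ltnW.
apply/andP; split.
  apply: expectation_ge0 => w.
  have := sum_nu_bounds (P := P N) (W := W N) (deg_torus (R := R) N2) D0 (hWpos N N1) (xs N) w
    (fun v => v \notin take (minn (J N) n) (xs N w)).
  by case/andP.
apply: le_trans (expectation_nu_le (deg_torus (R := R) N2) D0 (hW N N1) (hWpos N N1) (hxs N N1)
  n_gt0 J0 Bk (mug _) (mug _) gk EM) _.
(* A quarter for each of the three errors; the last one is slack. *)
rewrite lee_fin (_ : eps = eps / 4 + eps / 4 + eps / 4 + eps / 4); last by field.
rewrite -[leLHS]addr0 lerD ?divr_ge0 ?(ltW eps0)// !lerD//.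
- rewrite mulrC ler_pdivrMr ?ltr0n//; apply: (le_trans b1).
  by move: JN; rewrite ler_pdivrMr//; lra.
- rewrite (_ : eps / 4 = K^-1); last by rewrite /K invf_div.
  by rewrite lef_pV2// posrE// (lt_le_trans K0).
- by rewrite mulrA (mulrC _ n%:R); apply: (le_trans b2).
Unshelve. all: by end_near.
Qed.

Theorem proposition9p2 (R : realType) (d : nat) (hd : (2 <= d)%N)
  (alpha : R) (halpha0 : 0 < alpha) (halpha1 : alpha < 1)
  (L : R -> R) (hL : slowly_varying L)
  (mu : probability (measurableTypeR R) R)
  (hmu : forall t : R, 0 < t -> mu [set` `]t, +oo[] = (L t * t `^ (- alpha))%:E)
  (disp : nat -> measure_display) (T : forall N, measurableType (disp N))
  (P : forall N, probability (T N) R)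
  (W : forall N, nat -> {RV (P N) >-> R})
  (hW : forall N, (1 < N)%N -> iid_with_law mu (W N))
  (hWpos : forall N, (1 < N)%N -> forall j w, 0 < W N j w)
  (xs : forall N, T N -> #|torus d N|.-tuple (torus d N))
  (hxs : forall N, (1 < N)%N -> random_enumeration (W N) (xs N))
  (dispw : nat -> measure_display) (Om : forall N, measurableType (dispw N))
  (Q : forall N, torus d N -> probability (Om N) R)
  (Z : forall N, nat -> Om N -> torus d N)
  (hZ : forall N, (1 < N)%N -> is_lazy_walk (torus_adj d N) (Q N) (Z N)) :
  [/\
   (forall X Y : forall N, T N -> torus d N,
     (forall N, (1 < N)%N ->
       [/\ uniform_on (P N) predT (X N), uniform_on (P N) predT (Y N)
         & indep_pair (P N) (X N) (Y N)]) ->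
     P N [set w | ~ rooted_equiv (torus_adj d N)
                     (X N w) (gball (torus_adj d N) (X N w) (ell d N : R))
                     (Y N w) (gball (torus_adj d N) (Y N w) (ell d N : R))]
       @[N --> \oo] --> 0%E),
   (forall J : nat -> nat, {homo J : m n / (m <= n)%N} -> J @ \oo --> \oo ->
     'E_(P N)[fun w => (
        \sum_(v | v \notin take (minn (J N) #|torus d N|) (xs N w))
           nu (torus_adj d N) (W N) (xs N) w v)%R]%E
       @[N --> \oo] --> 0%E),
   (forall X : forall N, T N -> torus d N,
     (forall N, (1 < N)%N -> uniform_on (P N) predT (X N)) ->
     'E_(P N)[fun w => (
        #|gball (torus_adj d N) (X N w) (2 * ell d N : R)|%:R /
        #|torus d N|%:R)%R]%E
       @[N --> \oo] --> 0%E)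
   & (forall X : forall N, T N -> torus d N,
     (forall N, (1 < N)%N -> uniform_on (P N) predT (X N)) ->
     'E_(P N)[fun w => (
        sup [set fine (Q N y [set w' |
               (hitting_time (Z N) (X N w) w' <=
                (Lscale d N)%:E * mixing_time (torus_adj d N) (Q N) (Z N))%E])
            | y in [set y | y \notin
                       gball (torus_adj d N) (X N w) (ell d N : R)]])%R]%E
       @[N --> \oo] --> 0%E)].
Proof.
split.
- by move=> X Y _; exact: torus_balls_equiv.
- by move=> J _ Joo; exact: (torus_weight_tail hd halpha0 halpha1 hL hmu hW hWpos hxs Joo).
- by move=> X _; exact: torus_ball_volume.
- by move=> X _; exact: (torus_hitting_before_mixing hd P hZ X).
Qed.
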